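(* Let $G$ be a bridgeless cubic graph and let $e=uw$ be an edge of $G$. Let $G'$ be the graph obtained from $G$ by subdividing $e$ once with a new vertex $v_e$, adding a new vertex $t$, and adding the edge $v_et$. If $G'$ is simple, then $\chi'_N(G')\leq 7$, i.e., $G'$ admits a $7$-edge-coloring in which every edge other than $v_et$ is poor or rich.
   Context: Graphs may have parallel edges but no loops. A $k$-edge-coloring of a graph is an assignment of colors from $\{1,\dots,k\}$ to its edges such that adjacent edges receive different colors. For an edge-coloring $c$ and a vertex $v$, let $S_c(v)$ be the set of colors of the edges incident to $v$. An edge $xy$ whose endpoints both have degree three is poor with respect to $c$ if $|S_c(x)\cup S_c(y)|=3$ and rich if $|S_c(x)\cup S_c(y)|=5$. For the graph $G'$ (all of whose vertices have degree three except $t$, which has degree one), a normal edge-coloring is an edge-coloring in which every edge except the bridge $v_et$ is poor or rich (no constraint is imposed on $v_et$), and $\chi'_N(G')$ is the smallest $k$ for which $G'$ admits a normal $k$-edge-coloring. *)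

(* Defs.v *)
From mathcomp Require Import all_boot.

Set Implicit Arguments.
Unset Strict Implicit.
Unset Printing Implicit Defensive.

(* Finite multigraphs: [ends] need not be injective, so parallel edges are
   allowed; every edge has two distinct ends, so there are no loops. *)
Record mgraph := MGraph {
  vert : finType;
  edge : finType;
  ends : edge -> {set vert};
  ends2 : forall f, #|ends f| = 2
}.

Arguments ends {m} f.

Section Graph.
Variable G : mgraph.

Definition inc_edges (v : vert G) : {set edge G} := [set f | v \in ends f].

Definition degree (v : vert G) : nat := #|inc_edges v|.

Definition cubic : Prop := forall v, degree v = 3.

Definition simple : Prop := injective (@ends G).

Definition adj_without (f : edge G) : rel (vert G) :=
  fun x y => [exists g, (g != f) && (ends g == [set x; y])].

(* An edge is a bridge if it separates its two ends. *)
Definition bridge (f : edge G) : Prop :=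
  forall x y, ends f = [set x; y] -> ~~ connect (adj_without f) x y.

Definition bridgeless : Prop := forall f, ~ bridge f.

Section Coloring.
Variables (k : nat) (c : edge G -> 'I_k).

Definition edge_coloring : Prop :=
  forall f g, f != g -> ends f :&: ends g != set0 -> c f != c g.

Definition colors_at (v : vert G) : {set 'I_k} := [set c f | f in inc_edges v].

Definition poor (f : edge G) : Prop :=
  exists x y, [/\ ends f = [set x; y], degree x = 3, degree y = 3
                & #|colors_at x :|: colors_at y| = 3].

Definition rich (f : edge G) : Prop :=
  exists x y, [/\ ends f = [set x; y], degree x = 3, degree y = 3
                & #|colors_at x :|: colors_at y| = 5].

(* [b] is the one edge on which no poor/rich condition is imposed. *)
Definition normal_coloring (b : edge G) : Prop :=
  edge_coloring /\ forall f, f != b -> poor f \/ rich f.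

End Coloring.

(* [k] is the normal chromatic index of [G] with exempt edge [b].  This is a
   relation because a graph with parallel edges may have no normal
   edge-coloring at all. *)
Definition normal_index (b : edge G) (k : nat) : Prop :=
  (exists c : edge G -> 'I_k, normal_coloring c b) /\
  (forall j, (exists c : edge G -> 'I_j, normal_coloring c b) -> k <= j).

End Graph.

Section Subdivide.
Variables (G : mgraph) (e : edge G).

(* The new vertex is [None].  The edge [e] is replaced by one half-edge
   [inr x], joining [x] to the new vertex, for each of the two ends [x] of
   [e]. *)
Definition subdivide_edge : finType :=
  ({f : edge G | f != e} + {x : vert G | x \in ends e})%type.

Definition subdivide_ends (f : subdivide_edge) : {set option (vert G)} :=
  match f with
  | inl g => Some @: ends (val g)
  | inr x => [set Some (val x); None]
  end.

Lemma subdivide_ends2 f : #|subdivide_ends f| = 2.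
Proof.
case: f => [g|x] /=; last by rewrite cards2.
by rewrite card_imset ?ends2 //; apply: Some_inj.
Qed.

Definition subdivide : mgraph := MGraph subdivide_ends2.

End Subdivide.

Section Pendant.
Variables (H : mgraph) (v : vert H).

(* Both the new vertex and the new edge are [None]. *)
Definition pendant_ends (f : option (edge H)) : {set option (vert H)} :=
  match f with
  | Some g => Some @: ends g
  | None => [set Some v; None]
  end.

Lemma pendant_ends2 f : #|pendant_ends f| = 2.
Proof.
case: f => [g|] /=; last by rewrite cards2.
by rewrite card_imset ?ends2 //; apply: Some_inj.
Qed.

Definition add_pendant : mgraph := MGraph pendant_ends2.

End Pendant.

Section Prime.
Variables (G : mgraph) (e : edge G).

Definition v_e : vert (subdivide e) := None.

Definition gprime : mgraph := add_pendant v_e.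

(* The edge joining [v_e] to the new vertex [t]. *)
Definition pendant_edge : edge gprime := None.

End Prime.

(* Main.v *)
Require Import Defs.
From mathcomp Require Import all_boot all_algebra zify.
From Stdlib Require Import Classical_Prop.

Set Implicit Arguments.
Unset Strict Implicit.
Unset Printing Implicit Defensive.

Import GRing.Theory.

(** A nowhere-zero flow with values in F_2^3 colors a cubic graph so that the
    colors at each vertex form a line of the Fano plane; two such lines meeting
    on an edge are equal or have five points in all, so the coloring is normal.
    Subdivide [e]; the two half-edges [p] and [q] must get distinct colors.  The
    color of [p] can be changed alone, to the point [b] outside the three lines
    at the end [w] of [p] and at the other two neighbors of [w], provided these
    lines form a triangle, that is, provided the flow takes the value at [p] on
    none of the four edges leaving these neighbors.  Such a flow exists unless
    one of these edges forms a 2-edge cut with [p]: in Jaeger's proof of the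
    8-flow theorem, the three spanning trees given by matroid union can be chosen
    so that none of them contains [p] and two of them share none of four
    prescribed edges.  In the exceptional case one side of the 2-edge cut is
    treated by induction and the other side keeps the flow, up to a linear
    automorphism.  If [p] and [q] end at two adjacent vertices these are removed,
    and reinserted with the colors of the two edges swapped. *)

(** * Matroid intersection *)

(** The rank axioms of a matroid. They give [r I <= #|I|], so [#|I| <= r I] says that [I] is
    independent. *)
Definition rank_fun (T : finType) (r : {set T} -> nat) : Prop :=
  [/\ r set0 = 0,
      forall x A, r (x |: A) <= (r A).+1,
      forall A B : {set T}, A \subset B -> r A <= r B
    & forall A B, r (A :|: B) + r (A :&: B) <= r A + r B].

Lemma rank_fun_contract (T : finType) (r : {set T} -> nat) (x : T) :
  rank_fun r -> rank_fun (fun A => r (x |: A) - r [set x]).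
Proof.
move=> [r0 r1 rm rs]; split=> [|y A|A B sAB|A B].
- by rewrite setU0 subnn.
- have := r1 y (x |: A); have := rm [set x] (x |: A) (subsetUl _ _).
  by rewrite setUCA; lia.
- by rewrite leq_sub2r // rm // setUS.
- have := rs (x |: A) (x |: B); rewrite -setUUr -setUIr.
  have m C := rm [set x] (x |: C) (subsetUl _ _).
  by move: (m (A :|: B)) (m (A :&: B)) (m A) (m B); lia.
Qed.

(* Edmonds' matroid intersection theorem.  Deleting or contracting an element
   [x] preserves the hypothesis: otherwise the two violating sets could be
   uncrossed by submodularity. *)
Lemma matroid_intersection (T : finType) (r1 r2 : {set T} -> nat)
    (S : {set T}) (k : nat) :
  rank_fun r1 -> rank_fun r2 ->
  (forall X : {set T}, X \subset S -> k <= r1 X + r2 (S :\: X)) ->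
  exists I : {set T}, [/\ I \subset S, #|I| = k, k <= r1 I & k <= r2 I].
Proof.
elim: {S}_.+1 {-2}S (ltnSn #|S|) r1 r2 k => // n IH S leSn r1 r2 k R1 R2 mink.
case: (R1) => r10 r11 r1m r1s; case: (R2) => r20 r21 r2m r2s.
have [k0|k_gt0] := posnP k.
  by exists set0; rewrite k0 sub0set cards0.
have [S0|[x xS]] := set_0Vmem S.
  by have := mink set0 (sub0set _); rewrite S0 setD0 r10 r20 addn0 leqn0; lia.
have ltS'n : #|S :\ x| < n by rewrite (cardsD1 x) xS in leSn.
have sS'S : S :\ x \subset S by apply: subsetDl.
have [/forall_inP del|] :=
  boolP [forall (X : {set T} | X \subset S :\ x), k <= r1 X + r2 (S :\ x :\: X)].
  have [I [sI cI kI1 kI2]] := IH _ ltS'n r1 r2 k R1 R2 del.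
  by exists I; rewrite (subset_trans sI).
rewrite negb_forall_in => /exists_inP[A sA]; rewrite -ltnNge => ltA.
have xA : x \notin A by apply/negP=> /(subsetP sA); rewrite !inE eqxx.
have sAS := subset_trans sA sS'S.
have SA : S :\: A = x |: (S :\ x :\: A).
  apply/setP=> y; rewrite !inE; case: eqP => [->|_] //=.
  by rewrite xA xS.
have SxA : S :\: (x |: A) = S :\ x :\: A.
  by apply/setP=> y; rewrite !inE negb_or; case: (y == x); rewrite ?andbF.
have sxAS : x |: A \subset S by rewrite subUset sub1set xS.
(* If [x] were a loop for [r1], then [x |: A] would violate [mink]; if it were one for [r2], then
   [A] would. *)
have r1x : r1 [set x] = 1.
  have := r11 x set0; rewrite setU0 r10 => le1.
  have [r1x|] := posnP (r1 [set x]); last lia.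
  have := r1s [set x] A; rewrite r1x.
  by have := mink _ sxAS; rewrite SxA; lia.
have r2x : r2 [set x] = 1.
  have := r21 x set0; rewrite setU0 r20 => le1.
  have [r2x|] := posnP (r2 [set x]); last lia.
  have := r2s [set x] (S :\ x :\: A); rewrite r2x -SA.
  by have := mink _ sAS; lia.
have mx r (R : rank_fun r) C : r [set x] <= r (x |: C).
  by case: R => _ _ m _; rewrite m ?subsetUl.
have [/forall_inP con|] := boolP [forall (X : {set T} | X \subset S :\ x),
    k.-1 <= (r1 (x |: X) - r1 [set x]) +
            (r2 (x |: (S :\ x :\: X)) - r2 [set x])].
  have [I [sI cI kI1 kI2]] := IH _ ltS'n _ _ k.-1
    (rank_fun_contract x R1) (rank_fun_contract x R2) con.
  have xI : x \notin I by apply/negP=> /(subsetP sI); rewrite !inE eqxx.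
  exists (x |: I); rewrite subUset sub1set xS (subset_trans sI) // cardsU1 xI.
  move: (mx _ R1 I) (mx _ R2 I) kI1 kI2; rewrite r1x r2x cI /=.
  by clear -k_gt0; split=> //; lia.
rewrite negb_forall_in => /exists_inP[B sB]; rewrite -ltnNge r1x r2x => ltB.
have sBS := subset_trans sB sS'S.
have xB : x \notin B by apply/negP=> /(subsetP sB); rewrite !inE eqxx.
have SB : x |: (S :\ x :\: B) = S :\: B.
  apply/setP=> y; rewrite !inE; case: eqP => [->|_] //=.
  by rewrite xB xS.
have m1 := mx _ R1 B; have m2 := mx _ R2 (S :\ x :\: B).
(* The rank sums of the two violating sets total at most [2k - 1], whereas [mink] at [A :&: B] and
   at [A :|: (x |: B)] demands [2k]. *)
have := r1s A (x |: B); have := r2s (S :\ x :\: A) (x |: (S :\ x :\: B)).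
have -> : A :&: (x |: B) = A :&: B.
  by apply/setP=> y; rewrite !inE; case: eqP => // ->; rewrite (negPf xA).
have -> : (S :\ x :\: A) :|: (x |: (S :\ x :\: B)) = S :\: (A :&: B).
  apply/setP=> y; rewrite !inE; case: eqP => [->|_] /=.
    by rewrite (negPf xA) xS.
  by rewrite negb_and; case: (y \in A); case: (y \in B); case: (y \in S).
have -> : (S :\ x :\: A) :&: (x |: (S :\ x :\: B)) = S :\: (A :|: (x |: B)).
  apply/setP=> y; rewrite !inE; case: eqP => [->|_] /=; first by rewrite !andbF orbT.
  by case: (y \in A); case: (y \in B); case: (y \in S).
have sABS : A :&: B \subset S by rewrite subIset // sAS.
have sUS : A :|: (x |: B) \subset S by rewrite !subUset sAS sub1set xS sBS.
by rewrite r1x in m1; rewrite r2x in m2; move: (mink _ sABS) (mink _ sUS);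
  clear -ltA ltB m1 m2; lia.
Qed.

(** * Edge cuts and even flows *)

Section Cuts.
Variable G : mgraph.
Implicit Types (f g : edge G) (x y v : vert G) (Z : {set vert G}).
Implicit Types (X Y N : {set edge G}).

Definition cut Z : {set edge G} :=
  [set f | ~~ [disjoint ends f & Z] && ~~ (ends f \subset Z)].

Lemma endsP f : exists x y, x != y /\ ends f = [set x; y].
Proof.
by apply/cards2P/eqP/ends2.
Qed.

Lemma in_cut x y f Z :
  ends f = [set x; y] -> (f \in cut Z) = (x \in Z) (+) (y \in Z).
Proof.
rewrite inE => ->; rewrite -setI_eq0 setIUl setU_eq0 !setI_eq0 !disjoints1.
rewrite subUset !sub1set.
by case: (x \in Z); case: (y \in Z).
Qed.

End Cuts.

(** * The graphic matroid over F_2 and even flows *)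

Section Rank.
Variable G : mgraph.
Implicit Types (f g : edge G) (x y v : vert G) (Z : {set vert G}).
Implicit Types (X Y N : {set edge G}).
Local Open Scope ring_scope.

Let W : vectType bool := {ffun vert G -> bool^o}.

Lemma addWW (w : W) : w + w = 0.
Proof. by apply/ffunP=> v; rewrite !ffunE; apply: addbb. Qed.

Lemma addW_via (u v w : W) : u + w = (u + v) + (v + w).
Proof. by rewrite addrA -(addrA u) addWW addr0. Qed.

Definition vertex_vec v : W := [ffun u => u == v].
Definition edge_vec f : W := [ffun u => u \in ends f].
Definition edge_span X : {vspace W} := (\sum_(f in X) <[edge_vec f]>)%VS.
(** Rank in the graphic matroid: [edge_vec f] is the column of [f] in the incidence matrix over
    F_2. *)
Definition edge_rank X : nat := \dim (edge_span X).

Lemma edge_vecE f x y :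
  x != y -> ends f = [set x; y] -> edge_vec f = vertex_vec x + vertex_vec y.
Proof.
move=> nxy E; apply/ffunP=> u; rewrite !ffunE E !inE.
by case: eqP => [->|_]; case: eqP => // e; rewrite e eqxx in nxy.
Qed.

Lemma edge_spanS X Y : X \subset Y -> (edge_span X <= edge_span Y)%VS.
Proof.
move=> /subsetP sXY; apply/subv_sumP=> f /sXY fY.
exact: (sumv_sup f).
Qed.

Lemma edge_spanU X Y : edge_span (X :|: Y) = (edge_span X + edge_span Y)%VS.
Proof.
apply/eqP; rewrite eqEsubv subv_add !edge_spanS ?subsetUl ?subsetUr // !andbT.
rewrite {1}/edge_span; apply/subv_sumP=> f; rewrite inE => /orP[] fX.
  by apply: subv_trans (addvSl _ _); apply: (sumv_sup f).
by apply: subv_trans (addvSr _ _); apply: (sumv_sup f).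
Qed.

Lemma edge_span1 f : edge_span [set f] = <[edge_vec f]>%VS.
Proof. by rewrite /edge_span big_set1. Qed.

Lemma edge_rankS X Y : X \subset Y -> (edge_rank X <= edge_rank Y)%N.
Proof. by move=> sXY; rewrite dimvS ?edge_spanS. Qed.

(** This is the rank after contracting [N]. Submodularity is the dimension formula for the sum and
    the intersection of two spans. *)
Lemma edge_rank_fun N : rank_fun (fun X => edge_rank (X :|: N) - edge_rank N)%N.
Proof.
have mN X : (edge_rank N <= edge_rank (X :|: N))%N by rewrite edge_rankS ?subsetUr.
split=> [|f A|A B sAB|A B].
- by rewrite set0U subnn.
- have := (dimv_add_leqif <[edge_vec f]>%VS (edge_span (A :|: N))).1.
  rewrite dim_vline -edge_span1 -edge_spanU setUA.
  by move: (mN A); rewrite /edge_rank; case: (_ != 0); clear; lia.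
- by rewrite leq_sub2r // edge_rankS // setSU.
- suff : (edge_rank (A :|: B :|: N) + edge_rank (A :&: B :|: N)
          <= edge_rank (A :|: N) + edge_rank (B :|: N))%N.
    by move: (mN A) (mN B) (mN (A :|: B)) (mN (A :&: B)); clear; lia.
  rewrite setUUl setUIl /edge_rank edge_spanU.
  rewrite -[leqRHS]dimv_sum_cap leq_add2l dimvS //.
  by rewrite subv_cap !edge_spanS ?subsetIl ?subsetIr.
Qed.

(* Modulo the span of [Y] all vertices of a component of [Y] agree, so the edge
   space is generated by the differences of the [m] components of [Y] that some
   edge leaves: its dimension increases by at most [m - 1]. *)
Lemma edge_corank_bound N Y :
    (forall Z, cut Z != set0 -> [disjoint cut Z & N] -> 2 < #|cut Z|)%N ->
    N \subset Y -> (edge_rank Y < edge_rank setT)%N ->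
  (3 * (edge_rank setT - edge_rank Y) + 3 <= 2 * #|~: Y|)%N.
Proof.
move=> cutN sNY ltY.
pose adj : rel (vert G) := fun x y => [exists f in Y, ends f == [set x; y]].
have adjC : connect_sym adj.
  apply: sym_connect_sym => x y; apply: eq_existsb => f.
  by rewrite setUC.
pose rt := fingraph.root adj.
have rtY f x y : f \in Y -> ends f = [set x; y] -> rt x = rt y.
  move=> fY E; apply/eqP; rewrite /rt root_connect // connect1 //.
  by apply/exists_inP; exists f; rewrite ?E.
pose comp z := [set x | rt x == z].
have comp_cutE f x y z : ends f = [set x; y] ->
    (f \in cut (comp z)) = (rt x == z) (+) (rt y == z).
  by move=> /in_cut ->; rewrite !inE.
have comp_cutY f z : f \in cut (comp z) -> f \notin Y.
  have [x [y [_ E]]] := endsP f; rewrite (comp_cutE _ _ _ _ E).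
  by apply: contraL => fY; rewrite (rtY _ _ _ fY E) addbb.
pose D := [set z | cut (comp z) != set0].
have cutD f x y : ends f = [set x; y] -> rt x != rt y ->
    (rt x \in D) && (rt y \in D).
  move=> E nxy; rewrite !inE.
  by apply/andP; split; apply/set0Pn; exists f;
    rewrite (comp_cutE _ _ _ _ E) eqxx ?(eq_sym (rt y)) (negPf nxy).
(* Double counting: each of these component cuts avoids [N], hence has at least three edges, and an
   edge off [Y] lies in at most two of them. *)
have le3D : (3 * #|D| <= 2 * #|~: Y|)%N.
  have le1 : (3 * #|D| <= \sum_(z in D) #|cut (comp z)|)%N.
    rewrite mulnC -sum_nat_const leq_sum // => z; rewrite inE => nz.
    apply: cutN nz _; rewrite disjoint_subset; apply/subsetP=> f /comp_cutY.
    by rewrite inE; apply: contra; apply: (subsetP sNY).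
  apply: leq_trans le1 _.
  under eq_bigr do rewrite -sum1_card.
  rewrite (exchange_big_dep [in ~: Y]) /=; last first.
    by move=> z f _ /comp_cutY; rewrite inE.
  rewrite mulnC -sum_nat_const leq_sum // => f _; rewrite sum1_card.
  have [x [y [_ E]]] := endsP f.
  apply: leq_trans (_ : #|[set rt x; rt y]| <= _)%N; last first.
    by rewrite cards2; case: (_ != _).
  apply/subset_leq_card/subsetP=> z; rewrite !inE => /andP[_].
  move: (comp_cutE _ _ _ z E); rewrite !inE => ->.
  by rewrite !(eq_sym z); case: (rt x == z); case: (rt y == z).
have vertexY x : vertex_vec x + vertex_vec (rt x) \in edge_span Y.
  have /connectP[p] := connect_root adj x.
  rewrite -/(rt x); move: (rt x) => r; elim: p x => [|y p IH] x /=.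
    by move=> _ ->; rewrite addWW mem0v.
  case/andP=> /exists_inP[f fY /eqP E] /IH {}IH last_p.
  rewrite (addW_via _ (vertex_vec y)).
  apply: memvD; last exact: IH; rewrite -(@edge_vecE f) //; last first.
    by apply/eqP=> exy; have := ends2 f; rewrite E exy setUid cards1.
  by apply: subvP (memv_line _); rewrite -edge_span1 edge_spanS // sub1set.
have edgeY f x y : ends f = [set x; y] -> x != y ->
    edge_vec f + (vertex_vec (rt x) + vertex_vec (rt y)) \in edge_span Y.
  by move=> E nxy; rewrite (edge_vecE nxy E) addrACA memvD.
(* The rank gap yields an edge between two components, so [D] is nonempty and [#|D|.-1] is not
   truncated. *)
have crossE : exists f x y, ends f = [set x; y] /\ rt x != rt y.
  have /exists_inP[f _ fY] :
      [exists f in [set: edge G], edge_vec f \notin edge_span Y].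
    apply: contraTT ltY; rewrite negb_exists_in -leqNgt => /forall_inP noY.
    by apply: dimvS; rewrite {1}/edge_span; apply/subv_sumP=> f /noY /negPn.
  have [x [y [nxy E]]] := endsP f; exists f, x, y; split=> //.
  apply: contra fY => /eqP rxy; have := edgeY _ _ _ E nxy.
  by rewrite rxy addWW addr0.
have [z0 z0D] : exists z, z \in D.
  have [f [x [y [E nxy]]]] := crossE.
  by have /andP[xD _] := cutD _ _ _ E nxy; exists (rt x).
pose V0 := (\sum_(z in D :\ z0) <[vertex_vec z + vertex_vec z0]>)%VS.
have inV0 z : z \in D -> vertex_vec z + vertex_vec z0 \in V0.
  have [-> _|nz zD] := eqVneq z z0; first by rewrite addWW mem0v.
  by apply: subvP (memv_line _); rewrite (sumv_sup z) // in_setD1 nz.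
have sT : (edge_span setT <= edge_span Y + V0)%VS.
  rewrite {1}/edge_span; apply/subv_sumP=> f _; rewrite -memvE.
  have [x [y [nxy E]]] := endsP f.
  rewrite -[edge_vec f]addr0 -(addWW (vertex_vec (rt x) + vertex_vec (rt y))).
  rewrite addrA; apply: memv_add; first exact: edgeY.
  have [->|nr] := eqVneq (rt x) (rt y); first by rewrite addWW mem0v.
  have /andP[xD yD] := cutD _ _ _ E nr.
  rewrite (addW_via _ (vertex_vec z0)) [vertex_vec z0 + _]addrC.
  by rewrite memvD ?inV0.
have dimV0 : (\dim V0 <= #|D|.-1)%N.
  apply: leq_trans (dimv_leq_sum _ _ _) _.
  rewrite (cardsD1 z0 D) z0D /= -sum1_card leq_sum // => z _.
  by rewrite dim_vline; case: (_ != 0).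
have := leq_trans (dimvS sT) (dimv_add_leqif _ _).1.
move: ltY le3D dimV0; rewrite /edge_rank (cardsD1 z0 D) z0D /=; clear; lia.
Qed.

(** Applied to groups in which [a + a = 0]: signs disappear there, and a flow needs no
    orientation. *)
Definition even_flow (A : zmodType) (phi : edge G -> A) : Prop :=
  forall v, \sum_(f in inc_edges v) phi f = 0.

(** An even flow is a linear relation between edge vectors. As [Y] has full rank, the combination
    prescribed off [Y] is also a combination of vectors of [Y], and the two add up to zero. *)
Lemma even_flow_extend Y (psi : edge G -> bool) :
    edge_rank setT = edge_rank Y ->
  exists phi : edge G -> bool,
    even_flow phi /\ forall f, f \notin Y -> phi f = psi f.
Proof.
move=> rkY.
have spanY : edge_span setT = edge_span Y.
  apply/esym/eqP; rewrite eqEdim edge_spanS ?subsetT //=.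
  by rewrite -!/(edge_rank _) rkY.
have : \sum_(f in ~: Y) (psi f : bool^o) *: edge_vec f \in edge_span Y.
  rewrite -spanY; apply: memv_suml => f _; apply: memvZ.
  by apply: subvP (memv_line _); rewrite -edge_span1 edge_spanS ?subsetT.
case/memv_sumP=> vs vsP sumE.
have /fin_all_exists[k kE] : forall f, exists b : bool,
    f \in Y -> vs f = b *: edge_vec f.
  move=> f; have [fY|] := boolP (f \in Y); last by exists false.
  by have /vlineP[b] := vsP f fY; exists b.
exists (fun f => if f \in Y then k f else psi f); split; last first.
  by move=> f /negPf ->.
move=> v; have := congr1 (fun w : W => w v) sumE.
rewrite !sum_ffunE big_mkcond [in RHS]big_mkcond /= => sumvE.
rewrite big_mkcond /=.
apply/eqP; rewrite -[X in _ == X](addbb (\sum_i (if i \in Y then (vs i) v else 0))).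
rewrite -[X in X (+) _]sumvE -[_ (+) _]/(_ + _) -big_split /=; apply/eqP.
apply: eq_bigr => f _; rewrite in_setC inE.
have [fY|fY] := boolP (f \in Y) => /=.
  by rewrite kE // !ffunE; case: (v \in ends f); case: (k f).
by rewrite !ffunE; case: (v \in ends f); case: (psi f).
Qed.

(** Sum the vertex equations over [Z]: an edge with both ends in [Z] occurs twice and cancels. *)
Lemma even_flow_cut (A : zmodType) (phi : edge G -> A) Z :
    (forall a : A, a + a = 0) -> even_flow phi ->
  \sum_(f in cut Z) phi f = 0.
Proof.
move=> char2 phiE.
have : \sum_(v in Z) \sum_(f in inc_edges v) phi f = 0 by rewrite big1.
rewrite (exchange_big_dep predT) //= => sum0.
rewrite -[RHS]sum0 [LHS]big_mkcond /=; apply: eq_bigr => f _.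
have [x [y [nxy E]]] := endsP f.
rewrite (eq_bigl (fun v => (v \in [set x; y]) && (v \in Z))); last first.
  by move=> v; rewrite !inE E !inE andbC.
rewrite big_mkcondr big_setU1 ?in_set1 //= big_set1 (in_cut _ E).
by case: (x \in Z); case: (y \in Z); rewrite ?addr0 ?add0r // char2.
Qed.

End Rank.

(** * Nowhere-zero flows *)

(** A direct sum of matroids: [key] names the summand of each element, the only one whose rank the
    element can raise. *)
Lemma rank_fun_sum (T J : finType) (key : T -> J) (r : J -> {set T} -> nat) :
    (forall j, r j set0 = 0) ->
    (forall j x A, r j (x |: A) <= r j A + (j == key x)) ->
    (forall j (A B : {set T}), A \subset B -> r j A <= r j B) ->
    (forall j A B, r j (A :|: B) + r j (A :&: B) <= r j A + r j B) ->
  rank_fun (fun A => \sum_j r j A).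
Proof.
move=> r0 r1 rm rs; split=> [|x A|A B sAB|A B].
- by rewrite big1.
- rewrite -addn1 -(_ : \sum_j (j == key x) = 1); last first.
    rewrite (bigD1 (key x)) //= eqxx big1 // => j /negPf -> //.
  by rewrite -big_split leq_sum.
- by rewrite leq_sum // => j _; apply: rm.
- by rewrite -!big_split leq_sum.
Qed.

(** * Three copies of each edge, one per spanning set *)

Section Slices.
Variable E : finType.

Definition slice (X : {set E * 'I_3}) (i : 'I_3) : {set E} :=
  [set f | (f, i) \in X].

Lemma sliceU1 x X i :
  slice (x |: X) i = if i == x.2 then x.1 |: slice X i else slice X i.
Proof.
case: x => f j; apply/setP=> g; rewrite !inE xpair_eqE /=.
by case: (i == j); rewrite ?andbT ?andbF !inE.
Qed.

Lemma rank_fun_slices (r : {set E} -> nat) :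
  rank_fun r -> rank_fun (fun X => \sum_i r (slice X i)).
Proof.
case=> r0 r1 rm rs; apply: (@rank_fun_sum _ _ snd (fun i X => r (slice X i))).
- by move=> i; rewrite -[RHS]r0; congr r; apply/setP=> f; rewrite !inE.
- by move=> i x X; rewrite sliceU1; case: eqP => _; rewrite ?addn1 ?addn0.
- move=> i A B /subsetP sAB; apply: rm.
  by apply/subsetP=> f; rewrite !inE; apply: sAB.
- move=> i A B; rewrite -(_ : slice A i :|: slice B i = slice (A :|: B) i).
    rewrite -(_ : slice A i :&: slice B i = slice (A :&: B) i) //.
    by apply/setP=> f; rewrite !inE.
  by apply/setP=> f; rewrite !inE.
Qed.

Let i1 : 'I_3 := lift ord0 ord0.
Let i2 : 'I_3 := lift ord0 (lift ord0 ord0).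

(* Rank of a set of copies of one edge when at most two of its three copies may
   be used; if [s] holds, at most one of the copies [i1] and [i2]. *)
Definition copy_rank (s : bool) (b : 'I_3 -> bool) : nat :=
  if s then b ord0 + (b i1 || b i2) else minn 2 (b ord0 + b i1 + b i2).

Definition copies_rank (Gs : {set E}) (X : {set E * 'I_3}) : nat :=
  \sum_f copy_rank (f \in Gs) (fun i => (f, i) \in X).

Lemma ord3P (i : 'I_3) : [\/ i = ord0, i = i1 | i = i2].
Proof.
by case: i => [[|[|[|//]]] lti]; [apply: Or31|apply: Or32|apply: Or33];
  apply: val_inj.
Qed.

Lemma copies_rank_fun Gs : rank_fun (copies_rank Gs).
Proof.
apply: (@rank_fun_sum _ _ fst
  (fun f X => copy_rank (f \in Gs) (fun i => (f, i) \in X))).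
- by move=> f; rewrite /copy_rank !inE; case: ifP.
- move=> f [g i] A; rewrite /copy_rank !inE !xpair_eqE /=.
  move: ((f, ord0) \in A) ((f, i1) \in A) ((f, i2) \in A) => b0 b1 b2.
  case: (f == g); last by rewrite addn0.
  by case: (ord3P i) => -> /=; case: (f \in Gs); case: b0 b1 b2 => [] [] [].
- move=> f A B /subsetP sAB; rewrite /copy_rank.
  move: (sAB (f, ord0)) (sAB (f, i1)) (sAB (f, i2)).
  move: ((f, ord0) \in A) ((f, i1) \in A) ((f, i2) \in A) => b0 b1 b2.
  move: ((f, ord0) \in B) ((f, i1) \in B) ((f, i2) \in B) => c0 c1 c2.
  by clear; case: (f \in Gs); clear; lia.
- move=> f A B; rewrite /copy_rank !inE.
  move: ((f, ord0) \in A) ((f, i1) \in A) ((f, i2) \in A) => b0 b1 b2.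
  move: ((f, ord0) \in B) ((f, i1) \in B) ((f, i2) \in B) => c0 c1 c2.
  by case: (f \in Gs); case: b0 b1 b2 c0 c1 c2 => [] [] [] [] [] [].
Qed.

Implicit Types (X : {set E * 'I_3}) (Gs : {set E}).

Lemma card_slice X i : #|slice X i| = \sum_f ((f, i) \in X : nat).
Proof.
rewrite -sum1_card big_mkcond; apply: eq_bigr => f _.
by rewrite inE; case: (_ \in X).
Qed.

Lemma card_slices X : #|X| = \sum_f \sum_i ((f, i) \in X : nat).
Proof.
rewrite pair_big /= -sum1_card [LHS]big_mkcond; apply: eq_bigr => -[f i] _ /=.
by case: (_ \in X).
Qed.

Lemma slice_copies_rank Gs X i : #|slice X i| <= copies_rank Gs X.
Proof.
rewrite card_slice leq_sum // => f _; rewrite /copy_rank.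
by case: (ord3P i) => ->; case: (f \in Gs);
  move: ((f, ord0) \in X) ((f, i1) \in X) ((f, i2) \in X) => [] [] [].
Qed.

(** Compare edge by edge: for [n] copies, [minn 2 n] is at least [2n / 3], and an edge of [Gs] falls
    short by at most [1 / 3], namely when exactly its copies [i1] and [i2] are present. *)
Lemma copies_rank_lower Gs X :
  2 * \sum_i #|slice X i| <= 3 * copies_rank Gs X + #|Gs|.
Proof.
under eq_bigr do rewrite card_slice.
rewrite exchange_big -sum1_card [X in _ + X]big_mkcond /= !big_distrr -big_split.
apply: leq_sum => f _; rewrite !big_ord_recl big_ord0 /copy_rank addn0 /=.
by case: (f \in Gs);
  move: ((f, ord0) \in X) ((f, i1) \in X) ((f, i2) \in X) => [] [] [].
Qed.

(** No edge has rank above its number of copies, so equality of the totals forces equality at every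
    edge. *)
Lemma copies_rank_full Gs X f : #|X| <= copies_rank Gs X ->
  \sum_i ((f, i) \in X : nat) <= copy_rank (f \in Gs) (fun i => (f, i) \in X).
Proof.
rewrite card_slices /copies_rank (bigD1 f) // [leqRHS](bigD1 f) //=.
move=> leX; rewrite -(leq_add2r (\sum_(g | g != f) \sum_i ((g, i) \in X : nat))).
apply: leq_trans leX _; rewrite leq_add2l.
apply: leq_sum => g _; rewrite !big_ord_recl big_ord0 /copy_rank addn0.
by case: (g \in Gs);
  move: ((g, ord0) \in X) ((g, i1) \in X) ((g, i2) \in X) => [] [] [].
Qed.

End Slices.


(** The vectors of F_2^3; the seven nonzero ones are the points of the Fano plane. *)
Notation color := (bool * bool * bool)%type.

Lemma addcc (a : color) : (a + a = 0)%R.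
Proof. by case: a => [[[] []] []]. Qed.

Lemma sum_color (I : finType) (P : pred I) (a b c : I -> bool) :
  (\sum_(i | P i) (a i, b i, c i) : color)%R =
  (\sum_(i | P i) a i, \sum_(i | P i) b i, \sum_(i | P i) c i)%R.
Proof.
elim: (index_enum I) => [|i s IH]; first by rewrite !big_nil.
by rewrite !big_cons IH; case: ifP.
Qed.

Section NowhereZero.
Variable G : mgraph.
Implicit Types (f g p : edge G) (Z : {set vert G}).

(** The series relation: every even flow takes the same value on two such edges. *)
Definition in_series f g :=
  (f == g) || [exists Z : {set vert G}, cut Z == [set f; g]].

Lemma even_flow_in_series (phi : edge G -> bool) f g :
  even_flow phi -> in_series f g -> phi f = phi g.
Proof.
move=> phiE; have [-> //|nfg] := eqVneq f g.
rewrite /in_series (negPf nfg) => /existsP[Z /eqP cutZ].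
have := even_flow_cut Z addbb phiE.
rewrite cutZ big_setU1 ?in_set1 //= big_set1.
by case: (phi f); case: (phi g).
Qed.

(** Take [R] maximal among the sets containing [p] without two edges in series; an edge in series
    with no member could be added. *)
Lemma series_transversal p : exists R : {set edge G},
  [/\ p \in R, {in R &, forall f g, in_series f g -> f = g}
    & forall f, exists2 g, g \in R & in_series f g].
Proof.
pose P (R : {set edge G}) :=
  (p \in R) && [forall f in R, forall g in R, in_series f g ==> (f == g)].
have P1 : P [set p].
  rewrite /P set11; apply/forall_inP=> f /set1P ->; apply/forall_inP=> g /set1P ->.
  by rewrite eqxx implybT.
have [R /maxsetP[/andP[pR RP] maxR] _] := maxset_exists P1.
exists R; split=> // [f g fR gR sfg|f].
  by have /forall_inP/(_ g gR)/implyP/(_ sfg)/eqP := forall_inP RP f fR.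
have [fR|fR] := boolP (f \in R); first by exists f; rewrite // /in_series eqxx.
have [/exists_inP[g gR sfg]|] := boolP [exists g in R, in_series f g].
  by exists g.
rewrite negb_exists_in => /forall_inP noR.
have simC g h : in_series g h = in_series h g.
  rewrite /in_series eq_sym; congr (_ || _).
  by apply: eq_existsb => Z; rewrite setUC.
have PfR : P (f |: R).
  rewrite /P !inE pR orbT; apply/forall_inP=> g /setU1P gR.
  apply/forall_inP=> h /setU1P hR; apply/implyP=> sgh.
  case: gR hR sgh => [->|gR] [->|hR] //.
  - by rewrite (negPf (noR h hR)).
  - by rewrite simC (negPf (noR g gR)).
  - by have /forall_inP/(_ h hR)/implyP := forall_inP RP g gR.
by rewrite -(maxR _ PfR (subsetUr _ _)) setU11 in fR.
Qed.

Let i1 : 'I_3 := lift ord0 ord0.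
Let i2 : 'I_3 := lift ord0 (lift ord0 ord0).

(** Intersect three copies of the graphic matroid contracted by [N] with the matroid of
    [copies_rank], omitting all copies of [p]. A common independent set of size [k] has three slices
    of full rank. *)
Lemma spanning_triple p (N Gs : {set edge G}) :
    (forall Z, cut Z != set0 -> [disjoint cut Z & N] -> 2 < #|cut Z|) ->
    p \notin N -> #|Gs| <= 4 ->
  exists T : 'I_3 -> {set edge G},
    [/\ forall i, edge_rank [set: edge G] = edge_rank (T i :|: N),
        forall i, p \notin T i,
        forall f, ~~ [&& f \in T ord0, f \in T i1 & f \in T i2]
      & forall g, g \in Gs -> ~~ ((g \in T i1) && (g \in T i2))].
Proof.
move=> cutN pN leGs.
pose S : {set edge G * 'I_3} := [set u | (u.1 != p) && (u.1 \notin N)].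
pose rk X := edge_rank (X :|: N) - edge_rank N.
have rkT : edge_rank N <= edge_rank [set: edge G] by rewrite edge_rankS ?subsetT.
have rkl X : edge_rank N <= edge_rank (X :|: N) <= edge_rank [set: edge G].
  by rewrite !edge_rankS ?subsetT ?subsetUr.
(* [p] lies off [slice X i :|: N] but has no copy in [S]; this turns the bound [3d + 3 <= 2(n + 1)]
   into [3d + 1 <= 2n]. *)
have sliceS (X : {set edge G * 'I_3}) i : X \subset S ->
    edge_rank (slice X i :|: N) < edge_rank [set: edge G] ->
    3 * (edge_rank [set: edge G] - edge_rank (slice X i :|: N)) + 1
      <= 2 * #|slice (S :\: X) i|.
  move=> /subsetP sXS ltX; have := edge_corank_bound cutN (subsetUr _ _) ltX.
  have -> : ~: (slice X i :|: N) = p |: slice (S :\: X) i.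
    apply/setP=> f; rewrite !inE /=; have [->|_] := eqVneq f p.
      by rewrite negb_or pN andbT; apply/negP=> /sXS; rewrite inE eqxx.
    by rewrite negb_or andbC; case: (f \in N); rewrite ?andbF ?andbT.
  by rewrite cardsU1 !inE eqxx andbF /=; clear; lia.
pose k := 3 * (edge_rank [set: edge G] - edge_rank N).
(* By [edge_corank_bound], each nonzero corank [d] of [slice X i :|: N]
   satisfies [3 d + 1 <= 2 n], where [n] is the number of edges in
   [slice (S :\: X) i], while [copies_rank] is at least two thirds of the total
   number of copies, up to an error of [4 / 3] due to [Gs]. *)
have minS (X : {set edge G * 'I_3}) : X \subset S ->
    k <= \sum_i rk (slice X i) + copies_rank Gs (S :\: X).
  move=> sXS; move: (sliceS X ^~ sXS).
  have := copies_rank_lower Gs (S :\: X).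
  have := slice_copies_rank Gs (S :\: X).
  rewrite !big_ord_recl !big_ord0 /k /rk.
  rewrite -/i1 -/i2 => le1 le2 le3.
  move: (le1 ord0) (le1 i1) (le1 i2) (le3 ord0) (le3 i1) (le3 i2) le2 leGs.
  move: (rkl (slice X ord0)) (rkl (slice X i1)) (rkl (slice X i2)) rkT.
  (* A single nonzero corank is bounded by means of [slice_copies_rank]. With at least two of them,
     the error drops from [4 / 3] to at most [2 / 3], which integrality removes. *)
  clear; lia.
have [I [sIS cI le1 le2]] := matroid_intersection
  (rank_fun_slices (edge_rank_fun N)) (copies_rank_fun Gs) minS.
have full f := copies_rank_full f (leq_trans (eq_leq cI) le2).
exists (slice I); split=> [i|i|f|g gGs].
- move: le1; rewrite !big_ord_recl big_ord0 -/i1 -/i2 /k.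
  move: (rkl (slice I ord0)) (rkl (slice I i1)) (rkl (slice I i2)) rkT.
  by case: (ord3P i) => ->; rewrite -/i1 -/i2; clear; lia.
- by apply/negP; rewrite inE => /(subsetP sIS); rewrite inE eqxx.
- move: (full f); rewrite !inE !big_ord_recl big_ord0 -/i1 -/i2 /copy_rank.
  rewrite -/i1 -/i2.
  by case: (f \in Gs);
    move: ((f, ord0) \in I) ((f, i1) \in I) ((f, i2) \in I) => [] [] [].
- move: (full g); rewrite !inE !big_ord_recl big_ord0 -/i1 -/i2 /copy_rank gGs.
  rewrite -/i1 -/i2.
  by move: ((g, ord0) \in I) ((g, i1) \in I) ((g, i2) \in I) => [] [] [].
Qed.

(* As in Jaeger's proof of the 8-flow theorem, each tree gives a coordinate equal
   to 1 off the tree.  The edges outside a transversal [R] of the 2-edge cuts are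
   contracted.  As [p] gets the value [(1, 0, 0)], the edges of [Gs] that are
   missing from [T i1] or [T i2] get another value. *)
Lemma nowhere_zero_flow p (Gs : {set edge G}) :
    (forall Z, #|cut Z| != 1) -> #|Gs| <= 4 -> p \notin Gs ->
    (forall g Z, g \in Gs -> cut Z != [set g; p]) ->
  exists phi : edge G -> color,
    [/\ even_flow phi, forall f, phi f != 0%R
      & forall g, g \in Gs -> phi g != phi p].
Proof.
move=> nobridge leGs pGs cutGs.
have [R [pR Rinj Rcov]] := series_transversal p.
have /fin_all_exists[rep repP] : forall f, exists g, g \in R /\ in_series f g.
  by move=> f; have [g] := Rcov f; exists g.
(* Contracting the complement of [R] leaves no 2-edge cut, since two edges of [R] forming one would
   be in series. *)
have cutN Z : cut Z != set0 -> [disjoint cut Z & ~: R] -> 2 < #|cut Z|.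
  rewrite -card_gt0 disjoints_subset setCK => cut0 sZR.
  suff /eqP n2 : #|cut Z| != 2 by move: cut0 (nobridge Z) n2; clear; lia.
  apply/negP=> /cards2P[f [g [nfg cutZ]]].
  have fR : f \in R by rewrite (subsetP sZR) // cutZ !inE eqxx.
  have gR : g \in R by rewrite (subsetP sZR) // cutZ !inE eqxx orbT.
  move/eqP: nfg; apply; apply: Rinj => //.
  by rewrite /in_series; apply/orP; right; apply/existsP; exists Z; rewrite cutZ.
have [||T [spanT pT notall nottwo]] :=
  spanning_triple (Gs := [set rep g | g in Gs]) (p := p) cutN.
- by rewrite inE negbK.
- exact: leq_trans (leq_imset_card _ _) leGs.
(* These are the values prescribed off the trees: 1 everywhere, except that [p] is to receive
   [(1, 0, 0)]. *)
pose psi (i : 'I_3) f := (f != p) || (i == ord0).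
have /fin_all_exists[phi phiP] : forall i, exists phi : edge G -> bool,
    even_flow phi /\ forall f, f \notin T i :|: ~: R -> phi f = psi i f.
  by move=> i; apply: even_flow_extend.
have phiR i f : f \in R -> f \notin T i -> phi i f = psi i f.
  by move=> fR fT; apply: (phiP i).2; rewrite !inE negb_or fT fR.
have phi_rep i f : phi i f = phi i (rep f).
  by apply: even_flow_in_series (phiP i).1 _; case: (repP f).
have phip i : phi i p = (i == ord0) by rewrite phiR // /psi eqxx.
exists (fun f => (phi ord0 f, phi i1 f, phi i2 f)); split.
- by move=> v; rewrite sum_color !(phiP _).1.
- move=> f; rewrite (phi_rep ord0) (phi_rep i1) (phi_rep i2); have [fR _] := repP f.
  have [->|nfp] := eqVneq (rep f) p; first by rewrite !phip.
  have := notall (rep f); rewrite !negb_and => /or3P[] /(phiR _ _ fR) ->;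
    by rewrite /psi nfp; do 2!case: (phi _ _).
- move=> g gGs; rewrite !phip (phi_rep ord0) (phi_rep i1) (phi_rep i2).
  have [gR sg] := repP g.
  (* Equality would put [g] in series with [p], which [pGs] and [cutGs] exclude. *)
  have ngp : rep g != p.
    apply: contraTneq sg => ->; rewrite /in_series negb_or negb_exists.
    rewrite (contraNneq _ pGs) => [|<- //]; apply/forallP=> Z.
    exact: cutGs.
  have := nottwo _ (imset_f rep gGs); rewrite negb_and => /orP[] /(phiR _ _ gR) ->;
    by rewrite /psi ngp; do 2!case: (phi _ _).
Qed.

End NowhereZero.

(** * The Fano plane *)

Section Colors.
Local Open Scope ring_scope.
Implicit Types (a b c d x y : color) (S : {set color}).

Definition is_line S : bool :=
  [exists a : color, exists b : color,
     [&& a != 0, b != 0, a != b & S == [set a; b; a + b]]].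

Definition normal_pair S1 S2 : bool :=
  let n := #|S1 :|: S2| in (n == 3)%N || (n == 5)%N.

(** The zero vector comes last, which leaves the indices below 7 to the nonzero ones; the explicit
    list also allows exhaustive checks by evaluation. *)
Definition colors : seq color :=
  let B := [:: true; false] in
  [seq (u, k) | u <- [seq (i, j) | i <- B, j <- B], k <- B].

Lemma mem_colors a : a \in colors.
Proof. by case: a => [[[] []] []]. Qed.

Lemma normal_pairC S1 S2 : normal_pair S1 S2 = normal_pair S2 S1.
Proof. by rewrite /normal_pair setUC. Qed.

Lemma card_set_seq (s : seq color) : #|[set z in s]| = size (undup s).
Proof.
by rewrite cardsE -(eq_card (mem_undup s)); apply/card_uniqP/undup_uniq.
Qed.

Lemma set3E a b c : [set a; b; c] = [set z in [:: a; b; c]].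
Proof. by apply/setP=> z; rewrite !inE orbA. Qed.

Definition normal_seq (s : seq color) : bool :=
  let n := size (undup s) in (n == 3)%N || (n == 5)%N.

Lemma normal_pair3 a b c x y z :
  normal_pair [set a; b; c] [set x; y; z] = normal_seq [:: a; b; c; x; y; z].
Proof.
rewrite /normal_pair /normal_seq -card_set_seq.
suff -> : [set a; b; c] :|: [set x; y; z] = [set u in [:: a; b; c; x; y; z]] by [].
by apply/setP=> u; rewrite !inE !orbA.
Qed.

Lemma lineP S :
  reflect (exists a b : color, [/\ a != 0, b != 0, a != b & S = [set a; b; a + b]])
          (is_line S).
Proof.
apply: (iffP existsP) => [[a /existsP[b /and4P[a0 b0 nab /eqP->]]]|].
  by exists a, b.
by case=> a [b [a0 b0 nab ->]]; exists a; apply/existsP; exists b; apply/and4P.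
Qed.

Lemma card_line S : is_line S -> #|S| = 3.
Proof.
case/lineP=> a [b [a0 b0 nab ->]]; rewrite set3E card_set_seq.
by move: a0 b0 nab; case: a => [[[] []] []]; case: b => [[[] []] []].
Qed.

Lemma line0 S : is_line S -> 0 \notin S.
Proof.
case/lineP=> a [b [a0 b0 nab ->]]; rewrite set3E inE.
by move: a0 b0 nab; case: a => [[[] []] []]; case: b => [[[] []] []].
Qed.

Lemma line_eq S x y : is_line S -> x \in S -> y \in S -> x != y ->
  [/\ x != 0, y != 0 & S = [set x; y; x + y]].
Proof.
move=> lS xS yS nxy; have S0 := line0 lS.
split; [by apply: contraNneq S0 => <-|by apply: contraNneq S0 => <-|].
case/lineP: lS xS yS => a [b [a0 b0 nab ->]].
rewrite !set3E => xS yS; apply/setP=> z; move: xS yS; rewrite !inE.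
have ab : a + (a + b) = b by rewrite addrA addcc add0r.
have ba : b + (a + b) = a by rewrite addrCA addcc addr0.
by case/or3P=> /eqP xE; case/or3P=> /eqP yE; move: nxy;
  rewrite xE yE ?eqxx // ?ab ?ba ?[a + b + _]addrC ?ab ?ba ?[b + a]addrC => _;
  case: (z == a); case: (z == b); case: (z == a + b).
Qed.

(** Two lines through [x] are equal or meet only in [x], so their union has 3 or 5 points. *)
Lemma line_normal_pair S1 S2 x :
  is_line S1 -> is_line S2 -> x \in S1 -> x \in S2 -> normal_pair S1 S2.
Proof.
have other S : is_line S -> exists2 y, y \in S & x != y.
  move=> lS; have := card_line lS; rewrite (cardsD1 x).
  have [->|[y]] := set_0Vmem (S :\ x); first by rewrite cards0; case: (_ \in _).
  by rewrite !inE => /andP[nyx yS] _; exists y; rewrite // eq_sym.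
move=> l1 l2 x1 x2; have [y y1 nxy] := other _ l1; have [z z2 nxz] := other _ l2.
have [x0 y0 ->] := line_eq l1 x1 y1 nxy.
have [_ z0 ->] := line_eq l2 x2 z2 nxz.
rewrite normal_pair3; move: x0 y0 z0 nxy nxz.
by case: x {other x1 x2} => [[[] []] []]; case: y {y1} => [[[] []] []];
   case: z {z2} => [[[] []] []].
Qed.

Lemma normal_pair_line S : is_line S -> normal_pair S S.
Proof. by move=> /card_line lS; rewrite /normal_pair setUid lS. Qed.

(* The lines [{a, c, a + c}], [{c, g, c + g}] and [{a + c, h, a + c + h}] form a
   triangle of the Fano plane and [b] is the point on none of them. *)
Lemma recolor a c g h :
    a != 0 -> c != 0 -> a != c ->
    g != 0 -> h != 0 -> g != c -> h != a + c ->
    a != g -> a != c + g -> a != h -> a != a + c + h ->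
  exists b, [/\ b != 0, b != a, b != c, b != a + c
    & [/\ normal_pair [set b; c; a + c] [set c; g; c + g],
          normal_pair [set b; c; a + c] [set a + c; h; a + c + h]
        & normal_pair [set b; c; a + c] [set b; a; b + a]]].
Proof.
move=> *; suff : has (fun b => [&& b != 0, b != a, b != c, b != a + c
    & [&& normal_pair [set b; c; a + c] [set c; g; c + g],
          normal_pair [set b; c; a + c] [set a + c; h; a + c + h]
        & normal_pair [set b; c; a + c] [set b; a; b + a]]]) colors.
  by case/hasP=> b _ /and5P[? ? ? ? /and3P[? ? ?]]; exists b.
under eq_has => b do rewrite !normal_pair3.
(* A form without set cardinalities, checked on all quadruples of colors by computation. *)
pose t (a c g h : color) :=
  [&& a != 0, c != 0, a != c, g != 0, h != 0, g != c, h != a + c,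
      a != g, a != c + g, a != h & a != a + c + h] ==>
  has (fun b => [&& b != 0, b != a, b != c, b != a + c
    & [&& normal_seq [:: b; c; a + c; c; g; c + g],
          normal_seq [:: b; c; a + c; a + c; h; a + c + h]
        & normal_seq [:: b; c; a + c; b; a; b + a]]]) colors.
have : all (fun a => all (fun c => all (fun g => all (t a c g) colors) colors)
                         colors) colors.
  by vm_compute.
move/allP/(_ a (mem_colors a))/allP/(_ c (mem_colors c)).
move/allP/(_ g (mem_colors g))/allP/(_ h (mem_colors h))/implyP; apply.
by do ?[apply/andP; split].
Qed.

(** A transvection: take a linear form equal to 1 at both [x] and [y], and add [x + y] wherever the
    form is 1. The form vanishes at [x + y], so this map is an involution. *)
Lemma color_automorphism x y : x != 0 -> y != 0 ->
  exists s : color -> color,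
    [/\ injective s, {morph s : a b / a + b} & s x = y].
Proof.
pose dot (u z : color) := (u.1.1 && z.1.1) (+) (u.1.2 && z.1.2) (+) (u.2 && z.2).
have dotD u : {morph dot u : a b / a + b >-> a (+) b}.
  by case: u => [[[] []] []] [[[] []] []] [[[] []] []].
move=> x0 y0; have [u dx dy] : exists2 u, dot u x & dot u y.
  suff : has (fun u => dot u x && dot u y) colors.
    by case/hasP=> u _ /andP[]; exists u.
  by move: x0 y0; case: x => [[[] []] []]; case: y => [[[] []] []].
have dxy : dot u (x + y) = false by rewrite dotD dx dy.
pose s (z : color) : color := if dot u z then z + (x + y) else z.
exists s; split.
- apply: (can_inj (g := s)) => z; rewrite /s; case dz: (dot u z);
    rewrite ?dz // (dotD u z) dz dxy /=.
  by rewrite -addrA addcc addr0.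
- move=> a b; rewrite /s dotD; case: (dot u a); case: (dot u b) => //=.
  + by rewrite addrACA addcc addr0.
  + by rewrite addrAC.
  + by rewrite -!addrA.
- by rewrite /s dx addrA addcc add0r.
Qed.

Lemma line_morph (s : color -> color) S :
  injective s -> {morph s : a b / a + b} -> is_line S -> is_line (s @: S).
Proof.
move=> sI sD /lineP[a [b [a0 b0 nab ->]]].
have s0 : s 0 = 0 by apply: (addIr (s 0)); rewrite -sD !add0r.
apply/lineP; exists (s a), (s b); rewrite -s0 !(inj_eq sI); split=> //.
by rewrite !imsetU !imset_set1 sD.
Qed.

End Colors.

(** * Pieces bounded by two edges *)

Lemma addc_eq0 (a b : color) : (a + b = 0 -> a = b)%R.
Proof. by move=> s0; rewrite -[LHS]addr0 -(addcc b) addrA s0 add0r. Qed.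

Section Pieces.
Variable K : mgraph.
Implicit Types (f g h p q r : edge K) (u v w x y z : vert K).
Implicit Types (A Z : {set vert K}) (c : edge K -> color).

Lemma cutC Z : cut (~: Z) = cut Z.
Proof.
apply/setP=> f; have [x [y [_ E]]] := endsP f.
by rewrite !(in_cut _ E) !inE addNb addbN negbK.
Qed.

Lemma ends_other f v : v \in ends f -> exists2 y, ends f = [set v; y] & v != y.
Proof.
have [x [y [nxy ->]]] := endsP f; rewrite !inE => /orP[/eqP->|/eqP->].
  by exists y.
by exists x; rewrite 1?setUC // eq_sym.
Qed.

Lemma ends_neq f x y : ends f = [set x; y] -> y != x.
Proof.
by move=> E; apply: contra_eqN (ends2 f) => /eqP yx; rewrite E yx setUid cards1.
Qed.

Lemma cut_inside f A : f \in cut A ->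
  exists x y, [/\ ends f = [set x; y], x \in A & y \notin A].
Proof.
have [x [y [nxy E]]] := endsP f; rewrite (in_cut _ E).
have [xA|xA] /= := boolP (x \in A) => yA; first by exists x, y.
by exists y, x; rewrite setUC xA yA.
Qed.

Lemma ends_cutF f A : ends f \subset A -> f \notin cut A.
Proof. by rewrite inE => ->; rewrite andbF. Qed.

Lemma in_cutD1 A x f : x \in A ->
  (f \in cut (A :\ x)) = (x \in ends f) (+) (f \in cut A).
Proof.
move=> xA; have [xf|xf] := boolP (x \in ends f).
  have [y E nxy] := ends_other xf.
  by rewrite !(in_cut _ E) !inE eqxx xA eq_sym nxy; case: (y \in A).
have [a [b [_ E]]] := endsP f; rewrite !(in_cut _ E) !inE.
by move: xf; rewrite E !inE negb_or !(eq_sym x) => /andP[-> ->].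
Qed.

Lemma in_inc f v : (f \in inc_edges v) = (v \in ends f).
Proof. by rewrite inE. Qed.

Lemma other_edges v f : degree v = 3 -> f \in inc_edges v ->
  exists g h, [/\ inc_edges v = [set f; g; h], f != g, f != h & g != h].
Proof.
rewrite /degree (cardsD1 f) => + fv; rewrite fv => -[] /eqP/cards2P[g [h [ngh E]]].
exists g, h; rewrite -setUA -E setD1K //; split=> //.
  by have := set21 g h; rewrite -E !inE eq_sym => /andP[].
by have := set22 g h; rewrite -E !inE eq_sym => /andP[].
Qed.

Lemma third_edge v f g :
    degree v = 3 -> f \in inc_edges v -> g \in inc_edges v -> f != g ->
  exists h, [/\ inc_edges v = [set f; g; h], f != h & g != h].
Proof.
move=> dv fv; have [a [b [E nfa nfb nab]]] := other_edges dv fv.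
rewrite E !inE => /orP[/orP[/eqP->|/eqP->]|/eqP->]; rewrite ?eqxx // => _.
  by exists b.
by exists a; rewrite setUAC (eq_sym b).
Qed.

Definition palette c v : {set color} := [set c f | f in inc_edges v].

Lemma palette3 c v f g h :
  inc_edges v = [set f; g; h] -> palette c v = [set c f; c g; c h].
Proof. by rewrite /palette => ->; rewrite !imsetU !imset_set1. Qed.

Lemma mem_palette c f v : v \in ends f -> c f \in palette c v.
Proof. by move=> vf; apply: imset_f; rewrite inE. Qed.

Lemma eq_palette c c' v :
  (forall f, v \in ends f -> c f = c' f) -> palette c v = palette c' v.
Proof. by move=> cc'; apply: eq_in_imset => f; rewrite inE => /cc'. Qed.

Lemma flow3 (phi : edge K -> color) v f g h :
    even_flow phi -> (forall f, phi f != 0%R) ->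
    inc_edges v = [set f; g; h] -> f != g -> f != h -> g != h ->
  phi h = (phi f + phi g)%R /\ phi f != phi g.
Proof.
move=> phiE phi0 E nfg nfh ngh; have := phiE v.
rewrite E -setUA !big_setU1 ?inE ?negb_or ?nfg ?nfh //= big_set1.
rewrite addrA => /addc_eq0/esym phih; split=> //.
by apply: contraNneq (phi0 h) => fg; rewrite phih fg addcc.
Qed.

Lemma flow_palette (phi : edge K -> color) v :
    even_flow phi -> (forall f, phi f != 0%R) -> degree v = 3 ->
  is_line (palette phi v).
Proof.
move=> phiE phi0 dv.
have [f fv] : exists f, f \in inc_edges v.
  by apply/set0Pn; rewrite -card_gt0 -/(degree v) dv.
have [g [h [E nfg nfh ngh]]] := other_edges dv fv.
have [phih nphi] := flow3 phiE phi0 E nfg nfh ngh.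
by rewrite (palette3 _ E) phih; apply/lineP; exists (phi f), (phi g).
Qed.

Lemma flow_cut2 (phi : edge K -> color) Z f g :
  even_flow phi -> f != g -> cut Z = [set f; g] -> phi f = phi g.
Proof.
move=> phiE nfg cutZ; have := even_flow_cut Z addcc phiE.
by rewrite cutZ big_setU1 ?inE //= big_set1 => /addc_eq0.
Qed.

(* A coloring, by nonzero vectors, of the edges meeting [A] that would be
   normal if the two edges [p] and [q] leaving [A] were joined to a vertex with
   third color [c p + c q].  The last clause is what allows flow-colored
   subgraphs to be attached at [q]. *)
Definition piece_coloring A p q c : Prop :=
  [/\ forall v, v \in A -> (#|palette c v| = 3) /\ (0%R \notin palette c v),
      forall f x y, ends f = [set x; y] -> x \in A -> y \in A ->
        normal_pair (palette c x) (palette c y),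
      c p != c q,
      forall x, x \in A -> x \in ends p ->
        normal_pair (palette c x) [set c p; c q; (c p + c q)%R]
    & forall x, x \in A -> x \in ends q -> is_line (palette c x)].

Hypothesis no_cut1 : forall Z, #|cut Z| != 1.

Lemma cut1F Z f : cut Z <> [set f].
Proof. by move=> E; have := no_cut1 Z; rewrite E cards1. Qed.

(** * Reductions and base case for one piece *)

Section Piece.
Variables (A : {set vert K}) (p q : edge K).
Hypotheses (cubicA : forall v, v \in A -> degree v = 3)
  (simpleA : forall f g, ends f \subset A -> ends f = ends g -> f = g)
  (npq : p != q) (cutA : cut A = [set p; q]).

Lemma pcut : p \in cut A. Proof. by rewrite cutA set21. Qed.
Lemma qcut : q \in cut A. Proof. by rewrite cutA set22. Qed.

Lemma cut_unique f x y : f \in cut A -> x \in A -> y \in A ->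
  x \in ends f -> y \in ends f -> x = y.
Proof.
move=> /cut_inside[a [b [-> aA bA]]] xA yA; rewrite !inE.
by case/orP=> /eqP xE /orP[] /eqP yE; rewrite xE yE // ?xE ?yE in xA yA bA *;
  rewrite ?xA ?yA in bA.
Qed.

Lemma ends_inside f x : x \in A -> x \in ends f -> f != p -> f != q ->
  ends f \subset A.
Proof.
move=> xA xf nfp nfq; have : f \notin cut A by rewrite cutA !inE negb_or nfp.
rewrite inE negb_and negbK => /orP[/pred0P/(_ x)|]; last by rewrite negbK.
by rewrite /= xf xA.
Qed.

(** If [p] and [q] met at [x], removing [x] from [A] would leave a cut consisting of the third edge
    at [x] alone. *)
Lemma cut_ends_disjoint x : x \in A -> x \in ends p -> x \notin ends q.
Proof.
move=> xA xp; apply/negP=> xq.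
have [|||h [E nph nqh]] := third_edge (f := p) (g := q) (cubicA xA); rewrite ?inE //.
apply: (@cut1F (A :\ x) h); apply/setP=> f; rewrite in_cutD1 // cutA in_set1 in_set2.
rewrite -[x \in ends f]in_inc E !inE.
have [->|nfp] := eqVneq f p; first by rewrite (negPf nph).
have [->|nfq] := eqVneq f q; first by rewrite (negPf nqh).
by rewrite addbF.
Qed.


Lemma inside_neq g : ends g \subset A -> (g != p) && (g != q).
Proof.
by move=> /ends_cutF; rewrite cutA !inE negb_or.
Qed.

(** Up to complement, [Z] contains the inner end of [p]. If it contained the ends of [q], the cut of
    [A :\: Z] would be [g] alone; hence [A :&: Z] is the new piece, proper because [Z] separates the
    ends of [g]. *)
Lemma smaller_piece g Z : ends g \subset A -> cut Z = [set g; p] ->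
  exists2 A1 : {set vert K}, A1 \proper A & cut A1 = [set p; g].
Proof.
move=> gA; have /andP[ngp ngq] := inside_neq gA.
have [w [w' [pE wA w'A]]] := cut_inside pcut.
wlog wZ : Z / w \in Z => [wlog_w cutZ|cutZ].
  have [wZ|wZ] := boolP (w \in Z); first exact: (wlog_w Z).
  by apply: (wlog_w (~: Z)); rewrite ?inE // cutC.
have w'Z : w' \notin Z.
  by have := in_cut Z pE; rewrite cutZ set22 wZ; case: (w' \in Z).
have [q1 [q2 [qE q1A q2A]]] := cut_inside qcut.
have q12 : (q1 \in Z) = (q2 \in Z).
  have := in_cut Z qE; rewrite cutZ !inE (eq_sym q) (negPf ngq) eq_sym (negPf npq).
  by case: (q1 \in Z); case: (q2 \in Z).
have cutAE f a b : ends f = [set a; b] ->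
    ((a \in A) (+) (b \in A) = (f == p) || (f == q)) *
    ((a \in Z) (+) (b \in Z) = (f == g) || (f == p)).
  by move=> E; rewrite -!(in_cut _ E) cutA cutZ !inE.
have [x [y [_ gE]]] := endsP g.
have [xA yA] : x \in A /\ y \in A.
  by move: gA; rewrite gE subUset !sub1set => /andP.
have gZ : (x \in Z) (+) (y \in Z).
  by rewrite (cutAE _ _ _ gE) eqxx.
have [q1Z|q1Z] := boolP (q1 \in Z).
  case: (@cut1F (A :\: Z) g); apply/setP=> f; rewrite in_set1.
  have [->|nfg] := eqVneq f g.
    by rewrite (in_cut _ gE) !inE xA yA !andbT addNb addbN negbK.
  have [->|nfp] := eqVneq f p.
    by rewrite (in_cut _ pE) !inE wZ (negPf w'A) andbF.
  have [->|nfq] := eqVneq f q.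
    by rewrite (in_cut _ qE) !inE q1Z (negPf q2A) andbF.
  have [a [b [_ E]]] := endsP f; rewrite (in_cut _ E) !inE.
  have [] := cutAE _ _ _ E; rewrite (negPf nfg) (negPf nfp) (negPf nfq).
  by case: (a \in A); case: (b \in A); case: (a \in Z); case: (b \in Z).
exists (A :&: Z).
  rewrite properE subsetIl /=; apply/subsetP=> sAI.
  by move: gZ (sAI x xA) (sAI y yA); rewrite !inE xA yA;
    case: (x \in Z); case: (y \in Z) => //= _ h1 h2.
apply/setP=> f; rewrite in_set2.
have [->|nfp] := eqVneq f p.
  by rewrite (in_cut _ pE) !inE wZ wA (negPf w'A).
have [->|nfg] := eqVneq f g; first by rewrite (in_cut _ gE) !inE xA yA.
have [->|nfq] := eqVneq f q.
  by rewrite (in_cut _ qE) !inE (negPf q1Z) (negPf q2A) andbF.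
have [a [b [_ E]]] := endsP f; rewrite (in_cut _ E) !inE.
have [] := cutAE _ _ _ E; rewrite (negPf nfg) (negPf nfp) (negPf nfq).
by case: (a \in A); case: (b \in A); case: (a \in Z); case: (b \in Z).
Qed.

(** The edges meeting [A1] keep [c1]; the rest of [A] carries a flow followed by an automorphism
    that makes it agree with [c1] at [g]. *)
Lemma extend_piece (A1 : {set vert K}) g c1 :
    A1 \subset A -> ends g \subset A -> cut A1 = [set p; g] ->
    piece_coloring A1 p g c1 ->
  exists c, piece_coloring A p q c.
Proof.
move=> sA1 gA cutA1 [palette1 nrm1 npg1 p1 g1].
have /andP[ngp ngq] := inside_neq gA.
have [|||phi [phiE phi0 _]] := @nowhere_zero_flow K p set0 no_cut1.
- by rewrite cards0.
- by rewrite inE.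
- by move=> g' Z'; rewrite inE.
(* Both [p], [q] and [p], [g] form 2-edge cuts, so the flow has one value on all three; hence [q]
   will receive the color [c1 g]. *)
have phig : phi g = phi q.
  by rewrite -(flow_cut2 phiE npq cutA) (flow_cut2 phiE _ cutA1) // eq_sym.
have [pcut1 gcut1] : p \in cut A1 /\ g \in cut A1.
  by rewrite cutA1 set21 set22.
have [x [y [gE xA1 yA1]]] := cut_inside gcut1.
have c1g0 : c1 g != 0%R.
  by apply: contraNneq (palette1 x xA1).2 => <-; rewrite mem_palette // gE set21.
have [s [sI sD sg]] := color_automorphism (phi0 g) c1g0.
pose c f := if [disjoint ends f & A1] then s (phi f) else c1 f.
have pA1 v : v \in A -> v \in ends p -> v \in A1.
  move=> vA vp; have [w [w' [pE wA1 w'A1]]] := cut_inside pcut1.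
  by rewrite (cut_unique pcut vA (subsetP sA1 w wA1)) // pE set21.
have cA1 f v : v \in A1 -> v \in ends f -> c f = c1 f.
  move=> vA1 vf; rewrite /c; case: ifP => // /pred0P/(_ v).
  by rewrite /= vf vA1.
have c_out f v : v \in A -> v \notin A1 -> v \in ends f -> c f = s (phi f).
  move=> vA vA1 vf; rewrite /c; case: ifPn => // fA1.
  have : f \in cut A1.
    by rewrite inE fA1; apply/subsetPn; exists v.
  rewrite cutA1 !inE => /orP[/eqP fp|/eqP->]; last by [].
  by rewrite pA1 ?fp // -fp in vA1.
have paletteA1 v : v \in A1 -> palette c v = palette c1 v.
  by move=> vA1; apply: eq_palette => f; apply: cA1.
have palette_out v : v \in A -> v \notin A1 -> is_line (palette c v).
  move=> vA vA1; rewrite (eq_palette (c' := fun f => s (phi f))); last first.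
    by move=> f; apply: c_out.
  rewrite /palette (imset_comp s phi).
  by apply: line_morph => //; apply: flow_palette => //; apply: cubicA.
have qA1 v : v \in ends q -> v \in A -> v \notin A1.
  move=> vq vA; apply/negP=> vA1.
  have : q \in cut A1.
    have [q1 [q2 [qE q1A q2A]]] := cut_inside qcut.
    rewrite (in_cut _ qE) (contraNF (subsetP sA1 q2)) // addbF.
    by rewrite -(cut_unique qcut vA q1A vq) // qE set21.
  by rewrite cutA1 !inE eq_sym (negPf npq) eq_sym (negPf ngq).
have cp : c p = c1 p.
  have [w [w' [pE wA w'A]]] := cut_inside pcut.
  by apply: (@cA1 p w); rewrite ?pA1 // pE set21.
have cq : c q = c1 g.
  have [q1 [q2 [qE q1A q2A]]] := cut_inside qcut.
  have q1q : q1 \in ends q by rewrite qE set21.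
  by rewrite (c_out q q1) ?qA1 // -phig.
exists c; split.
- move=> v vA; have [vA1|vA1] := boolP (v \in A1).
    by rewrite paletteA1 //; apply: palette1.
  by have lv := palette_out v vA vA1; rewrite (card_line lv) line0.
- move=> f a b fE aA bA.
  wlog aA1 : a b fE aA bA / a \in A1 => [wlog_a|].
    have [aA1|aA1] := boolP (a \in A1); first exact: wlog_a.
    have [bA1|bA1] := boolP (b \in A1).
      by rewrite normal_pairC; apply: wlog_a; rewrite // setUC.
    by apply: (@line_normal_pair _ _ (c f));
      rewrite ?palette_out ?mem_palette // fE ?set21 ?set22.
  have [bA1|bA1] := boolP (b \in A1); first by rewrite !paletteA1 // (nrm1 f).
  have : f \in cut A1 by rewrite (in_cut _ fE) aA1.
  have bf : b \in ends f by rewrite fE set22.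
  have af : a \in ends f by rewrite fE set21.
  rewrite cutA1 !inE => /orP[/eqP fp|/eqP fg].
    by rewrite pA1 ?fp // -fp in bA1.
  (* Across [g], the last clause of [piece_coloring] makes the palette at the end in [A1] a line,
     like the palette at the other end. *)
  apply: (@line_normal_pair _ _ (c f)); rewrite ?mem_palette ?(palette_out b) //.
  by rewrite paletteA1 // g1 // -fg.
- by rewrite cp cq.
- by move=> v vA vp; rewrite cp cq paletteA1 ?p1 ?pA1.
- by move=> v vA vq; rewrite palette_out ?qA1.
Qed.


(** Delete the ends of the rung [r]. On reinsertion, [p] takes the color of [q'], [q] that of [p'],
    and [r] their sum, so that both new palettes equal the line spanned by the colors of [p'] and
    [q']. *)
Lemma rung_piece w z r :
    w \in A -> w \in ends p -> z \in A -> z \in ends q -> ends r = [set w; z] ->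
  exists p' q', [/\ p' != q', cut (A :\ w :\ z) = [set p'; q']
    & forall c1, piece_coloring (A :\ w :\ z) p' q' c1 ->
      exists c, piece_coloring A p q c].
Proof.
move=> wA wp zA zq rE.
have wr : w \in ends r by rewrite rE set21.
have zr : z \in ends r by rewrite rE set22.
have rA : ends r \subset A by rewrite rE subUset !sub1set wA.
have /andP[nrp nrq] := inside_neq rA.
have wq : w \notin ends q := cut_ends_disjoint wA wp.
have zp : z \notin ends p by apply: contraL zq => /(cut_ends_disjoint zA).
have nwz : w != z by apply: contraNneq wq => ->.
have [|||p' [wE npp' nrp']] := third_edge (f := p) (g := r) (cubicA wA);
  rewrite ?in_inc // 1?eq_sym //.
have [|||q' [zE nqq' nrq']] := third_edge (f := q) (g := r) (cubicA zA);
  rewrite ?in_inc // 1?eq_sym //.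
have wp' : w \in ends p' by rewrite -in_inc wE !inE eqxx !orbT.
have zq' : z \in ends q' by rewrite -in_inc zE !inE eqxx !orbT.
have p'A : ends p' \subset A.
  apply: (ends_inside wA wp'); first by rewrite eq_sym.
  by apply: contraNneq wq => <-.
have q'A : ends q' \subset A.
  apply: (ends_inside zA zq'); last by rewrite eq_sym.
  by apply: contraNneq zp => <-.
(* Otherwise [p'] would be parallel to [r], contrary to simplicity. *)
have zp' : z \notin ends p'.
  apply/negP=> zp'; have [y E nwy] := ends_other wp'.
  have zy : z = y by move: zp'; rewrite E !inE eq_sym (negPf nwz) => /eqP.
  by move/eqP: nrp'; apply; apply: simpleA; rewrite // rE E zy.
have np'q' : p' != q' by apply: contraNneq zp' => ->.
have wq' : w \notin ends q'.
  apply/negP; rewrite -in_inc wE !inE => /orP[/orP[]|] /eqP q'E.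
  - by move: zp; rewrite -q'E zq'.
  - by rewrite q'E eqxx in nrq'.
  - by rewrite q'E eqxx in np'q'.
have np'q : p' != q by apply: contraNneq wq => <-.
have nq'p : q' != p by apply: contraNneq zp => <-.
exists p', q'; split=> //.
  apply/setP=> f; have zAw : z \in A :\ w by rewrite !inE eq_sym nwz.
  rewrite !in_cutD1 // -!in_inc wE zE cutA !inE.
  have [->|nfp] := eqVneq f p.
    by rewrite (negPf npq) -(eq_sym r) (negPf nrp) -(eq_sym q') (negPf nq'p)
      (negPf npp').
  have [->|nfq] := eqVneq f q.
    by rewrite -(eq_sym r) (negPf nrq) (negPf nqq') -(eq_sym p') (negPf np'q).
  have [->|nfr] := eqVneq f r; first by rewrite (negPf nrp') (negPf nrq').
  by have [->|] := eqVneq f p'; rewrite ?(negPf np'q') //=; case: (f == q').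
move=> c1 [palette1 nrm1 npq1 p1 q1].
have inA1 v : v \in A -> v != w -> v != z -> v \in A :\ w :\ z.
  by move=> vA vw vz; rewrite !inE vz vw.
pose T : {set color} := [set c1 p'; c1 q'; (c1 p' + c1 q')%R].
have [y p'E nwy] := ends_other wp'; have [x q'E nzx] := ends_other zq'.
have yA1 : y \in A :\ w :\ z.
  apply: inA1; rewrite 1?eq_sym //.
    by move: p'A; rewrite p'E subUset !sub1set => /andP[].
  by apply: contraNneq zp' => ->; rewrite p'E set22.
have xA1 : x \in A :\ w :\ z.
  apply: inA1; rewrite 1?eq_sym //.
    by move: q'A; rewrite q'E subUset !sub1set => /andP[].
  by apply: contraNneq wq' => ->; rewrite q'E set22.
have c1_neq0 f v : v \in A :\ w :\ z -> v \in ends f -> c1 f != 0%R.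
  by move=> vA1 vf; apply: contraNneq (palette1 v vA1).2 => <-; rewrite mem_palette.
have lT : is_line T.
  apply/lineP; exists (c1 p'), (c1 q'); split=> //.
    by apply: (@c1_neq0 _ y); rewrite // p'E set22.
  by apply: (@c1_neq0 _ x); rewrite // q'E set22.
pose c f := if f == r then (c1 p' + c1 q')%R else
            if f == p then c1 q' else if f == q then c1 p' else c1 f.
have [cr cp cq cp' cq'] :
    [/\ c r = (c1 p' + c1 q')%R, c p = c1 q', c q = c1 p', c p' = c1 p'
      & c q' = c1 q'].
  rewrite /c !eqxx (negPf np'q) (negPf nq'p) !(eq_sym _ r).
  rewrite (negPf nrp) (negPf nrq) (negPf nrp') (negPf nrq').
  rewrite (eq_sym q) (negPf npq) (eq_sym p') (negPf npp').
  by rewrite (eq_sym q') (negPf nqq').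
have palette_w : palette c w = T.
  by rewrite (palette3 _ wE) cp cr cp' setUAC (setUC [set c1 q']).
have palette_z : palette c z = T.
  by rewrite (palette3 _ zE) cq cr cq' setUAC.
have pA v : v \in A -> v \in ends p -> v = w.
  by move=> vA vp; apply: (cut_unique pcut).
have qA v : v \in A -> v \in ends q -> v = z.
  by move=> vA vq; apply: (cut_unique qcut).
have palette_A1 v : v \in A :\ w :\ z -> palette c v = palette c1 v.
  rewrite !inE => /and3P[vz vw vA]; apply: eq_palette => f vf; rewrite /c.
  have [fr|_] := eqVneq f r.
    by move: vf; rewrite fr rE !inE (negPf vw) (negPf vz).
  have [fp|_] := eqVneq f p; first by rewrite (pA v) ?eqxx // -fp in vw.
  by have [fq|//] := eqVneq f q; rewrite (qA v) ?eqxx // -fq in vz.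
exists c; split.
- move=> v vA; have [->|vw] := eqVneq v w.
    by rewrite palette_w card_line ?line0.
  have [->|vz] := eqVneq v z; first by rewrite palette_z card_line ?line0.
  by have vA1 := inA1 v vA vw vz; rewrite palette_A1 //; apply: palette1.
- have nrm_w f v : ends f = [set w; v] -> v \in A -> normal_pair T (palette c v).
    move=> fE vA; have : f \in inc_edges w by rewrite inE fE set21.
    have vf : v \in ends f by rewrite fE set22.
    have [->|vz] := eqVneq v z; first by rewrite palette_z normal_pair_line.
    have nvw : v != w := ends_neq fE.
    have vA1 := inA1 v vA nvw vz.
    rewrite wE !inE => /orP[/orP[]|] /eqP fE'.
    + by rewrite (pA v) ?eqxx // -fE' in nvw.
    + by move: vf; rewrite fE' rE !inE (negPf nvw) (negPf vz).
    (* Along [p'], the smaller piece guarantees normality with [T]; along [q'], treated below, it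
       guarantees a line through [c1 q']. *)
    + by rewrite palette_A1 // normal_pairC p1 // -fE'.
  have nrm_z f v : ends f = [set z; v] -> v \in A -> normal_pair T (palette c v).
    move=> fE vA; have : f \in inc_edges z by rewrite inE fE set21.
    have vf : v \in ends f by rewrite fE set22.
    have [->|vw] := eqVneq v w; first by rewrite palette_w normal_pair_line.
    have nvz : v != z := ends_neq fE.
    have vA1 := inA1 v vA vw nvz.
    rewrite zE !inE => /orP[/orP[]|] /eqP fE'.
    + by rewrite (qA v) ?eqxx // -fE' in nvz.
    + by move: vf; rewrite fE' rE !inE (negPf vw) (negPf nvz).
    + apply: (@line_normal_pair _ _ (c1 q')) => //;
        rewrite ?palette_A1 // -?fE' ?mem_palette //.
        by apply: q1; rewrite // -fE'.
      by rewrite fE' !inE eqxx orbT.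
  move=> f a b fE aA bA; have fE' : ends f = [set b; a] by rewrite fE setUC.
  have [aw|aw] := eqVneq a w; first by rewrite aw palette_w (nrm_w f) // fE aw.
  have [az|az] := eqVneq a z; first by rewrite az palette_z (nrm_z f) // fE az.
  rewrite normal_pairC; have [bw|bw] := eqVneq b w.
    by rewrite bw palette_w (nrm_w f) // fE' bw.
  have [bz|bz] := eqVneq b z; first by rewrite bz palette_z (nrm_z f) // fE' bz.
  by rewrite !palette_A1 ?inA1 // (nrm1 f) ?inA1.
- by rewrite cp cq eq_sym.
- move=> v vA /(pA v vA) ->; rewrite palette_w cp cq (setUC [set c1 q']).
  by rewrite addrC; apply: normal_pair_line.
- by move=> v vA /(qA v vA) ->; rewrite palette_z.
Qed.


(** As [q] misses the far ends of [e] and [d], the other edges at these ends lie inside [A]. None of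
    them forms a 2-edge cut with [p], so a flow can avoid the value of [p] on all of them, and
    [recolor] applies. *)
Lemma base_piece w e d :
    w \in A -> inc_edges w = [set p; e; d] -> p != e -> p != d -> e != d ->
    (forall x, x \in A -> x \in ends q -> (x \notin ends e) && (x \notin ends d)) ->
    (forall g Z, ends g \subset A -> cut Z != [set g; p]) ->
  exists c, piece_coloring A p q c.
Proof.
move=> wA wE npe npd ned q_ed cutgp.
have [wp we wd] : [/\ w \in ends p, w \in ends e & w \in ends d].
  by rewrite -!in_inc wE !inE !eqxx !orbT.
have wq : w \notin ends q := cut_ends_disjoint wA wp.
have inside f : f != p -> w \in ends f -> ends f \subset A.
  move=> nfp wf; apply: (ends_inside wA wf) => //.
  by apply: contraNneq wq => <-.
have [z1 eE nwz1] := ends_other we; have [z2 dE nwz2] := ends_other wd.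
have eA : ends e \subset A by apply: inside; rewrite // eq_sym.
have dA : ends d \subset A by apply: inside; rewrite // eq_sym.
have z1e : z1 \in ends e by rewrite eE set22.
have z2d : z2 \in ends d by rewrite dE set22.
have z1A : z1 \in A := subsetP eA z1 z1e.
have z2A : z2 \in A := subsetP dA z2 z2d.
have inside_z z f : z \in A -> z != w -> z \notin ends q -> z \in ends f ->
    ends f \subset A.
  move=> zA nzw zq zf; apply: (ends_inside zA zf).
    apply: contraNneq nzw => fp; apply/eqP.
    by apply: (cut_unique pcut); rewrite // -fp.
  by apply: contraNneq zq => <-.
have z1q : z1 \notin ends q.
  by apply/negP=> /(q_ed z1 z1A)/andP[]; rewrite z1e.
have z2q : z2 \notin ends q.
  by apply/negP=> /(q_ed z2 z2A)/andP[_]; rewrite z2d.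
have [|g1 [g2 [z1E neg1 neg2 ng12]]] := other_edges (f := e) (cubicA z1A).
  by rewrite in_inc.
have [|h1 [h2 [z2E ndh1 ndh2 nh12]]] := other_edges (f := d) (cubicA z2A).
  by rewrite in_inc.
pose Gs := [set g1; g2; h1; h2].
have GsA g : g \in Gs -> ends g \subset A.
  have gz1 f : f \in inc_edges z1 -> ends f \subset A.
    by rewrite in_inc; apply: inside_z; rewrite // eq_sym.
  have gz2 f : f \in inc_edges z2 -> ends f \subset A.
    by rewrite in_inc; apply: inside_z; rewrite // eq_sym.
  rewrite !inE -!orbA => /or4P[] /eqP->;
    [apply: gz1|apply: gz1|apply: gz2|apply: gz2]; by rewrite ?z1E ?z2E !inE eqxx ?orbT.
have [|||phi [phiE phi0 phip]] := @nowhere_zero_flow K p Gs no_cut1.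
- apply: leq_trans (subset_leq_card _) (card_size [:: g1; g2; h1; h2]).
  by apply/subsetP=> g; rewrite !inE -!orbA.
- by apply/negP=> /GsA/inside_neq; rewrite eqxx.
- by move=> g Z /GsA; apply: cutgp.
have [phid nphi] := flow3 phiE phi0 wE npe npd ned.
have [phig2 nphig] := flow3 phiE phi0 z1E neg1 neg2 ng12.
have [phih2 nphih] := flow3 phiE phi0 z2E ndh1 ndh2 nh12.
have phiGs g : g \in Gs -> phi p != phi g by rewrite eq_sym; apply: phip.
have [|||||||||||b [b0 bp be bd [nz1 nz2 np]]] :=
    @recolor (phi p) (phi e) (phi g1) (phi h1); rewrite -?phid -?phig2 -?phih2 //.
- by rewrite eq_sym.
- by rewrite eq_sym.
- by apply: phiGs; rewrite !inE eqxx ?orbT.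
- by apply: phiGs; rewrite !inE eqxx ?orbT.
- by apply: phiGs; rewrite !inE eqxx ?orbT.
- by apply: phiGs; rewrite !inE eqxx ?orbT.
rewrite -phid in bd nz1 nz2 np; rewrite -phig2 in nz1; rewrite -phih2 in nz2.
pose c f := if f == p then b else phi f.
have cphi f : f != p -> c f = phi f by rewrite /c => /negPf->.
(* The cut equation leaves [q] with the old value of [p]; the new color [b] differs from it. *)
have cq : c q = phi p by rewrite cphi 1?eq_sym // (flow_cut2 phiE npq cutA).
have cp : c p = b by rewrite /c eqxx.
have palette_w : palette c w = [set b; phi e; phi d].
  by rewrite (palette3 _ wE) cp !cphi // eq_sym.
have pA v : v \in A -> v \in ends p -> v = w.
  by move=> vA vp; apply: (cut_unique pcut).
have palette_phi v : v \in A -> v != w -> palette c v = palette phi v.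
  move=> vA nvw; apply: eq_palette => f vf; apply: cphi.
  by apply: contraNneq nvw => fp; rewrite (pA v) // -fp.
have palette_line v : v \in A -> v != w -> is_line (palette c v).
  by move=> vA nvw; rewrite palette_phi //; apply: flow_palette => //; apply: cubicA.
exists c; split.
- move=> v vA; have [->|nvw] := eqVneq v w; last first.
    by rewrite card_line ?line0 // palette_line.
  have ned' : phi e != phi d.
    rewrite phid; apply: contraNneq (phi0 p) => E.
    by rewrite -(addr0 (phi p)) -(addcc (phi e)) addrA -E addcc.
  rewrite palette_w !inE !negb_or !(eq_sym 0%R) b0 !phi0; split=> //.
  by rewrite -setUA !cardsU1 !inE negb_or be bd ned' cards1.
- have nrm_w f v : ends f = [set w; v] -> v \in A -> normal_pair (palette c w) (palette c v).
    move=> fE vA; have : f \in inc_edges w by rewrite inE fE set21.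
    have nvw : v != w := ends_neq fE.
    have vf : v \in ends f by rewrite fE set22.
    rewrite wE !inE => /orP[/orP[]|] /eqP fE'.
    + by rewrite (pA v) ?eqxx // -fE' in nvw.
    + have -> : v = z1.
        by move: vf; rewrite fE' eE !inE (negPf nvw) => /eqP.
      by rewrite palette_w palette_phi 1?eq_sym // (palette3 _ z1E).
    + have -> : v = z2.
        by move: vf; rewrite fE' dE !inE (negPf nvw) => /eqP.
      by rewrite palette_w palette_phi 1?eq_sym // (palette3 _ z2E).
  move=> f x y fE xA yA; have fE' : ends f = [set y; x] by rewrite fE setUC.
  have [xw|xw] := eqVneq x w; first by rewrite xw (nrm_w f) // fE xw.
  have [yw|yw] := eqVneq y w; first by rewrite yw normal_pairC (nrm_w f) // fE' yw.
  by apply: (@line_normal_pair _ _ (c f));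
    rewrite ?palette_line ?mem_palette // fE !inE eqxx ?orbT.
- by rewrite cp cq.
- by move=> v vA /(pA v vA)->; rewrite palette_w cp cq.
- move=> v vA vq; apply: palette_line => //.
  by apply: contraNneq wq => <-.
Qed.

End Piece.

(** Induction on the size of [A]. A rung between the inner ends of [p] and [q], or a 2-edge cut
    formed by [p] and an edge inside [A], leads to a smaller piece; otherwise a flow is recolored at
    [p]. *)
Lemma piece_coloring_exists A p q :
    (forall v, v \in A -> degree v = 3) ->
    (forall f g, ends f \subset A -> ends f = ends g -> f = g) ->
    p != q -> cut A = [set p; q] ->
  exists c, piece_coloring A p q c.
Proof.
elim: {A}_.+1 {-2}A (ltnSn #|A|) p q => // n IH A leAn p q cubicA simpleA npq cutA.
have IHA (A1 : {set vert K}) p1 q1 :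
    A1 \proper A -> p1 != q1 -> cut A1 = [set p1; q1] ->
    exists c, piece_coloring A1 p1 q1 c.
  move=> ltA1 npq1 cutA1; have sA1 := proper_sub ltA1; apply: IH => //.
  - by apply: leq_trans (proper_card ltA1) _.
  - by move=> v /(subsetP sA1); apply: cubicA.
  - by move=> f g /subset_trans/(_ sA1); apply: simpleA.
have [w [w' [pE wA w'A]]] := cut_inside (pcut cutA).
have [z [z' [qE zA z'A]]] := cut_inside (qcut cutA).
have wp : w \in ends p by rewrite pE set21.
have zq : z \in ends q by rewrite qE set21.
have [|e [d [wE npe npd ned]]] := other_edges (f := p) (cubicA w wA).
  by rewrite inE.
have [we wd] : w \in ends e /\ w \in ends d.
  by rewrite -!in_inc wE !inE !eqxx !orbT.
have wq := cut_ends_disjoint cubicA npq cutA wA wp.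
have rung r : w \in ends r -> z \in ends r -> exists c, piece_coloring A p q c.
  move=> wr zr; have [y rE nwy] := ends_other wr.
  have zy : z = y.
    move: zr; rewrite rE !inE => /orP[/eqP zw|/eqP//].
    by rewrite -zw zq in wq.
  rewrite -zy in rE.
  have [p' [q' [np'q' cutA' ext]]] :=
    rung_piece cubicA simpleA npq cutA wA wp zA zq rE.
  have [|c1 /ext//] := IHA (A :\ w :\ z) p' q' _ np'q' cutA'.
  by rewrite (sub_proper_trans (subsetDl _ _)) // properD1.
have [/rung|ze] := boolP (z \in ends e); first exact.
have [/rung|zd] := boolP (z \in ends d); first exact.
have [/existsP[g /existsP[Z /andP[gA /eqP cutZ]]]|] :=
  boolP [exists g, exists Z : {set vert K},
           (ends g \subset A) && (cut Z == [set g; p])].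
  have [A1 ltA1 cutA1] := smaller_piece npq cutA gA cutZ.
  have /andP[ngp _] := inside_neq cutA gA.
  have [|c1] := IHA A1 p g ltA1 _ cutA1; first by rewrite eq_sym.
  exact: extend_piece (proper_sub ltA1) gA cutA1.
rewrite negb_exists => /forallP nocut.
apply: (base_piece cubicA npq cutA wA wE npe npd ned) => [x xA xq|g Z gA].
  by rewrite (cut_unique (qcut cutA) xA zA xq zq) ze zd.
by have := nocut g; rewrite negb_exists => /forallP/(_ Z); rewrite gA.
Qed.
End Pieces.

(** * Subdividing and adding the pendant edge *)

(** If [f] were the only edge of the cut, [Z] would be closed under adjacency avoiding [f], and [f]
    would be a bridge. *)
Lemma bridgeless_cut1 (G : mgraph) (Z : {set vert G}) :
  bridgeless G -> #|cut Z| != 1.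
Proof.
move=> noB; apply/negP=> /cards1P[f cutZ]; apply: (noB f) => x y E.
have clZ : closed (adj_without f) (mem Z).
  move=> a b /existsP[g /andP[ngf /eqP gE]].
  have : g \notin cut Z by rewrite cutZ inE.
  by rewrite (in_cut _ gE) /= negb_add => /eqP.
apply/negP=> /(closed_connect clZ)/= xy.
by have := in_cut Z E; rewrite cutZ set11 xy addbb.
Qed.

Section Subdivision.
Variables (G : mgraph) (e : edge G).
Let K := subdivide e.
Let A : {set vert K} := ~: [set None].

Definition origin (f : edge K) : edge G := if f is inl g then val g else e.

(** If the cut is [F] alone, the trace of [Z] on [G] has the cut [origin F] alone: [e] is in it
    precisely when one of its halves is [F]. *)
Lemma subdivide_cut1 (Z : {set vert K}) :
  (forall Z' : {set vert G}, #|cut Z'| != 1) -> #|cut Z| != 1.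
Proof.
move=> no1; apply/negP=> /cards1P[F cutZ].
have /negP[] := no1 [set x | Some x \in Z]; apply/cards1P; exists (origin F).
apply/setP=> f; have [x [y [nxy E]]] := endsP f.
rewrite (in_cut _ E) !inE.
have cutF F' a b : ends F' = [set a; b] -> (a \in Z) (+) (b \in Z) = (F' == F).
  by move=> F'E; rewrite -(in_cut _ F'E) cutZ inE.
have [fe|nfe] := eqVneq f e; last first.
  rewrite (cutF (inl (Sub f nfe) : edge K)); last first.
    by rewrite /= E imsetU !imset_set1.
  case: F {cutZ cutF} => [g|u] /=; last by rewrite (negPf nfe).
  by rewrite -[inl _ == _]/(_ == g) -val_eqE.
rewrite {}fe in E *.
have xe : x \in ends e by rewrite E set21.
have ye : y \in ends e by rewrite E set22.
have := cutF (inr (Sub x xe) : edge K) (Some x) None; move=> /(_ erefl).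
have := cutF (inr (Sub y ye) : edge K) (Some y) None; move=> /(_ erefl).
move=> cy cx.
(* Inserting the side of [None] twice compares [x] with [y] through the two half-edges. *)
rewrite -[_ (+) _]addbF -(addbb (None \in Z)) addbACA [X in _ (+) X]addbC cx.
rewrite [X in _ (+) X]addbC cy.
case: F {cutZ cutF cx cy} => [g|u] /=.
  by rewrite (eq_sym e) (negPf (valP g)).
rewrite eqxx -![inr _ == _]/(_ == u) -!val_eqE /=.
have : sval u \in [set x; y] by rewrite -E; apply: (valP u).
by rewrite !inE => /orP[] /eqP->; rewrite eqxx ?(eq_sym y) (negPf nxy).
Qed.

Lemma origin_inj v : {in inc_edges (Some v : vert K) &, injective origin}.
Proof.
move=> [f|x] [g|y]; rewrite !inE /=.
- by move=> _ _ /val_inj->.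
- by move=> _ _ fe; case/eqP: (valP f).
- by move=> _ _ /esym ge; case/eqP: (valP g).
by rewrite !orbF => /eqP[vx] /eqP[vy] _; congr inr; apply: val_inj; rewrite /= -vx.
Qed.

Lemma subdivide_degree v : degree (Some v : vert K) = degree v.
Proof.
rewrite /degree -(card_in_imset (@origin_inj v)); apply: eq_card => f.
apply/imsetP/idP => [[[g|x]]|]; rewrite inE => vf.
- by move=> ->; move: vf => /= /imsetP[u ug [->]]; rewrite inE.
- by move=> ->; move: vf; rewrite /= !inE orbF => /eqP[->]; apply: valP.
have [fe|nfe] := eqVneq f e.
  rewrite fe in vf; exists (inr (Sub v vf)); rewrite //= inE /= !inE eqxx //.
by exists (inl (Sub f nfe)); rewrite //= inE /= imset_f.
Qed.

(** The piece to be colored is everything except [v_e]; the edges leaving it are the two halves of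
    [e]. *)
Lemma subdivide_halves : exists p q : edge K,
  [/\ p != q, cut A = [set p; q]
    & forall f : edge K, (None : vert K) \in ends f -> f \in cut A].
Proof.
have [x [y [nxy E]]] := endsP e.
have xe : x \in ends e by rewrite E set21.
have ye : y \in ends e by rewrite E set22.
exists (inr (Sub x xe)), (inr (Sub y ye)).
split=> [||[g|u] //].
- by rewrite -[inr _ == _]/(_ == _ :> {v | v \in ends e}) -val_eqE.
- apply/setP=> -[g|u].
    rewrite !inE /=; apply/negbTE; rewrite negb_and !negbK; apply/orP; right.
    by apply/subsetP=> _ /imsetP[v _ ->]; rewrite !inE.
  rewrite (@in_cut K (Some (val u)) None) // !inE /=.
  rewrite -![inr _ == _]/(_ == _ :> {v | v \in ends e}) -!val_eqE /=.
  have : sval u \in [set x; y] by rewrite -E; apply: (valP u).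
  by rewrite !inE => /orP[] /eqP->; rewrite eqxx ?orbT.
- by move=> /imsetP[].
by move=> _; rewrite (@in_cut K (Some (val u)) None) // !inE.
Qed.

End Subdivision.

(** Faithful on nonzero colors only: the zero vector has index 7, out of range, and falls to the
    default of [inord]. *)
Definition color_code (a : color) : 'I_7 := inord (index a colors).

Lemma color_code_inj : {in predC1 0%R &, injective color_code}.
Proof.
move=> a b; rewrite !inE => a0 b0 /(congr1 (@nat_of_ord 7)).
have lt7 d : d != 0%R -> index d colors < 7 by case: d => [[[] []] []].
rewrite /color_code !inordK ?lt7 // => /(congr1 (nth 0%R colors)).
by rewrite !nth_index ?mem_colors.
Qed.

(** * The coloring of the graph with the pendant edge *)

Section Pendant.
Variables (G : mgraph) (e : edge G).
Let K := subdivide e.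
Let H := gprime e.
Let A : {set vert K} := ~: [set None].
Variables (p q : edge K) (c : edge K -> color).
Hypotheses (cubicG : cubic G) (npq : p != q) (cutA : cut A = [set p; q])
  (cut_None : forall f : edge K, (None : vert K) \in ends f -> f \in cut A)
  (cP : piece_coloring A p q c).

(** The sum on the pendant edge turns the palette at [v_e] into a line, as foreseen in
    [piece_coloring]. *)
Definition pendant_coloring (f : edge H) : color :=
  if f is Some f' then c f' else (c p + c q)%R.

Let T : {set color} := [set c p; c q; (c p + c q)%R].

Lemma inc_pendant (v : vert K) (f : edge K) :
  ((Some f : edge H) \in inc_edges (Some v : vert H)) = (v \in ends f).
Proof. by rewrite !inE /= mem_imset //; apply: Some_inj. Qed.

Lemma in_A (v : vert G) : (Some v : vert K) \in A.
Proof. by rewrite !inE. Qed.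

Lemma half_ends f : f \in cut A -> exists2 v : vert G,
  ends f = [set (Some v : vert K); None]
    & forall x, x \in A -> x \in ends f -> x = Some v.
Proof.
move=> fA; have [[v|] [[w|] [E]]] := cut_inside fA; rewrite !inE // => _ _.
exists v => // -[x|]; rewrite !inE // => _; rewrite E !inE orbF => /eqP //.
Qed.

Lemma line_T : is_line T.
Proof.
case: cP => palette1 _ ncpq _ _.
have c0 f : f \in cut A -> c f != 0%R.
  move=> fA; have [v E _] := half_ends fA.
  by apply: contraNneq (palette1 _ (in_A v)).2 => <-; rewrite mem_palette // E set21.
by apply/lineP; exists (c p), (c q); rewrite !c0 // cutA ?set21 ?set22.
Qed.

Lemma palette_Some (v : vert G) :
  palette pendant_coloring (Some (Some v) : vert H) = palette c (Some v : vert K).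
Proof.
apply/setP=> a; apply/imsetP/imsetP => [[[f|]]|[f]].
- by rewrite inc_pendant => vf ->; exists f; rewrite ?inE.
- by rewrite inE /= !inE.
- by rewrite inE => vf ->; exists (Some f); rewrite ?inc_pendant.
Qed.

Lemma inc_None :
  inc_edges (Some None : vert H) = [set (Some p : edge H); Some q; None].
Proof.
have pqN f : f \in cut A -> (None : vert K) \in ends f.
  by case/half_ends=> v -> _; rewrite set22.
apply/setP=> -[f|]; last by rewrite in_inc !in_setU !in_set1 eqxx !orbT.
rewrite inc_pendant !inE orbF; apply/idP/orP => [/cut_None|].
  by rewrite cutA !inE => /orP[]/eqP->; rewrite eqxx; [left|right].
by case=> /eqP[->]; apply: pqN; rewrite cutA ?set21 ?set22.
Qed.

Lemma palette_None : palette pendant_coloring (Some None : vert H) = T.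
Proof. exact: palette3 inc_None. Qed.

Lemma pendant_degree (v : vert K) : degree (Some v : vert H) = 3.
Proof.
case: v => [v|]; last first.
  rewrite /degree inc_None -setUA !cardsU1 !inE cards1 /= orbF.
  by rewrite (inj_eq Some_inj) npq.
rewrite -(cubicG v) -(subdivide_degree e v) /degree.
rewrite -[RHS](card_imset _ (@Some_inj _)); apply: eq_card => -[f|].
  by rewrite inc_pendant mem_imset ?in_inc //; apply: Some_inj.
by rewrite !inE; apply/esym/negbTE/imsetP => -[f _]; discriminate.
Qed.

Lemma palette_pendant (v : vert K) :
  #|palette pendant_coloring (Some v : vert H)| = 3 /\
  0%R \notin palette pendant_coloring (Some v : vert H).
Proof.
case: v => [v|].
  by rewrite palette_Some; case: cP => palette1 _ _ _ _; apply: palette1 (in_A v).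
by rewrite palette_None card_line ?line0 ?line_T.
Qed.

(** At [v_e] the palette is [T]. The fourth clause of [piece_coloring] settles the half [p]; the
    last clause settles [q], where two lines share [c q]. *)
Lemma pendant_normal_pair (f : edge K) (x y : vert K) : ends f = [set x; y] ->
  normal_pair (palette pendant_coloring (Some x : vert H))
      (palette pendant_coloring (Some y : vert H)).
Proof.
case: cP => palette1 nrm1 ncpq p1 q1.
have nrmT (v : vert G) : ends f = [set (Some v : vert K); None] ->
    normal_pair (palette c (Some v : vert K)) T.
  move=> E; have vf : (Some v : vert K) \in ends f by rewrite E set21.
  have : f \in cut A by apply: cut_None; rewrite E set22.
  rewrite cutA !inE => /orP[]/eqP fE.
    by apply: p1 (in_A v) _; rewrite -fE.
  apply: (@line_normal_pair _ _ (c q)); rewrite ?line_T -?fE ?mem_palette //.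
    by apply: q1 (in_A v) _; rewrite -fE.
  by rewrite fE !inE eqxx orbT.
case: x y => [x|] [y|] E; rewrite ?palette_Some ?palette_None.
- by apply: (nrm1 f); rewrite // in_A.
- exact: nrmT.
- by rewrite normal_pairC nrmT // setUC.
- by rewrite normal_pair_line ?line_T.
Qed.

Lemma pendant_normal :
  normal_coloring (color_code \o pendant_coloring) (pendant_edge e).
Proof.
have nz (v : vert K) a :
    a \in palette pendant_coloring (Some v : vert H) -> a != 0%R.
  by apply: contraTneq => ->; case: (palette_pendant v).
split=> [f g nfg /set0Pn[[v|]]|[f|] // _].
- rewrite inE => /andP[vf vg].
  (* The palette has as many colors as there are edges at the vertex, so the coloring is injective
     there. *)
  have /imset_injP inj : #|palette pendant_coloring (Some v : vert H)|
      == #|inc_edges (Some v : vert H)|.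
    by rewrite (palette_pendant v).1 -(pendant_degree v).
  apply: contra nfg => /eqP/color_code_inj fg; apply/eqP.
  apply: inj; rewrite ?in_inc //.
  by apply: fg; rewrite inE; apply: (nz v); apply: mem_palette.
- have tE h : (None : vert H) \in ends h -> h = None.
    by case: h => [h /imsetP[v _]|].
  by rewrite inE => /andP[/tE fN /tE gN]; rewrite fN gN eqxx in nfg.
have [x [y [_ E]]] := endsP f.
have colE (v : vert K) : colors_at (color_code \o pendant_coloring) (Some v : vert H)
    = color_code @: palette pendant_coloring (Some v : vert H).
  by rewrite /palette -imset_comp.
have cardE : #|colors_at (color_code \o pendant_coloring) (Some x : vert H) :|:
               colors_at (color_code \o pendant_coloring) (Some y : vert H)|
    = #|palette pendant_coloring (Some x : vert H) :|:
        palette pendant_coloring (Some y : vert H)|.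
  rewrite !colE -imsetU; apply: card_in_imset => a b; rewrite !inE => ax bx.
  by apply: color_code_inj; rewrite !inE; [case/orP: ax|case/orP: bx]; apply: nz.
have HE : ends (Some f : edge H) = [set (Some x : vert H); Some y].
  by rewrite -[ends _]/(Some @: ends f) E imsetU !imset_set1.
by case/orP: (pendant_normal_pair E) => /eqP n; [left|right];
  exists (Some x), (Some y); rewrite !pendant_degree cardE n.
Qed.

End Pendant.

(** Excluded middle is used because [P] is an arbitrary proposition, with no decision procedure to
    search by. *)
Lemma least_le (P : nat -> Prop) n :
  P n -> exists2 k, P k /\ (forall j, P j -> k <= j) & k <= n.
Proof.
elim/ltn_ind: n => n IH Pn.
have [[j [ltjn Pj]]|none] := classic (exists j, j < n /\ P j).
  have [k Pk lekj] := IH j ltjn Pj.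
  by exists k => //; apply: leq_trans lekj (ltnW ltjn).
exists n => //; split=> // j Pj; rewrite leqNgt.
by apply/negP=> ltjn; apply: none; exists j.
Qed.

Theorem theorem6 (G : mgraph) (e : edge G)
    (hbridgeless : bridgeless G) (hcubic : cubic G)
    (hsimple : simple (gprime e)) :
  (exists2 k : nat, normal_index (pendant_edge e) k & k <= 7) /\
  (exists c : edge (gprime e) -> 'I_7, normal_coloring c (pendant_edge e)).
Proof.
suff cP : exists c : edge (gprime e) -> 'I_7, normal_coloring c (pendant_edge e).
  by split=> //; apply: (least_le cP).
have [p [q [npq cutA cutN]]] := subdivide_halves e.
have no_cut1 (Z : {set vert (subdivide e)}) : #|cut Z| != 1.
  by apply: subdivide_cut1 => Z'; apply: bridgeless_cut1.
have [||c cP] := piece_coloring_exists no_cut1 _ _ npq cutA.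
- by case=> [v _|]; rewrite ?inE // subdivide_degree.
(* Edges with equal ends in the subdivision keep equal ends in [gprime e], where simplicity
   identifies them. *)
- move=> f g _ fg; apply: Some_inj; apply: hsimple.
  exact: (congr1 (fun S : {set vert (subdivide e)} => Some @: S) fg).
by exists (color_code \o pendant_coloring p q c); apply: pendant_normal.
Qed.
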